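(* Let $u>0$ and let $p(z)=\sum_{r=0}^Rp_rz^r$ with $R\ge1$, $p_R\ne0$. The solutions $w^{(j,k)}(u,z)$ ($j,k=0,\pm1$, $j<k$) of $d^2w/dz^2-u^2zw=p(z)$ are given by $$w^{(j,k)}(u,z)=\gamma(u)\,\mathrm{Wi}^{(j,k)}(u^{2/3}z)+\mathcal{G}(u,z),\qquad\gamma(u)=\frac{1}{u^{4/3}}\sum_{s=0}^{\lfloor R/3\rfloor}\frac{(3s)!\,p_{3s}}{3^ss!\,u^{2s}},$$ where, for $|z|\le r_0$ with fixed $r_0>0$ and each positive integer $m$, as $u\to\infty$, $$\mathcal{G}(u,z)=\frac{1}{u^2}\sum_{s=0}^{m-1}\frac{\hat G_s^*(z)}{u^{2s}}+\mathcal{O}\left(\frac{1}{u^{2m+2}}\right),$$ in which $$\hat G_0^*(z)=-\sum_{r=1}^Rp_rz^{r-1},\qquad\hat G_1^*(z)=-\sum_{r=4}^R(r-1)(r-2)p_rz^{r-4}\quad(R\ge4),$$ with subsequent terms $\hat G_s^*(z)$ being the analytic parts (regular parts of the Laurent expansions at $z=0$) of the coefficients $\hat G_s(z)$ given by $\hat G_0(z)=-\sum_{r=0}^Rp_rz^{r-1}$, $\hat G_{s+1}(z)=z^{-1}\hat G_s''(z)$ ($s=0,1,2,\dots$).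
   Context: $\mathrm{Ai}_j(x)=\mathrm{Ai}(xe^{-2\pi ij/3})$ for $j=0,\pm1$. The fundamental particular solutions are $$w^{(-1,1)}(u,z)=2\pi iu^{-2/3}\Big\{\mathrm{Ai}_{-1}(u^{2/3}z)\int_{\infty e^{2\pi i/3}}^zp(t)\mathrm{Ai}_1(u^{2/3}t)dt-\mathrm{Ai}_1(u^{2/3}z)\int_{\infty e^{-2\pi i/3}}^zp(t)\mathrm{Ai}_{-1}(u^{2/3}t)dt\Big\},$$ $$w^{(-1,0)}(u,z)=2\pi e^{\pi i/6}u^{-2/3}\Big\{\mathrm{Ai}_{-1}(u^{2/3}z)\int_\infty^zp(t)\mathrm{Ai}(u^{2/3}t)dt-\mathrm{Ai}(u^{2/3}z)\int_{\infty e^{-2\pi i/3}}^zp(t)\mathrm{Ai}_{-1}(u^{2/3}t)dt\Big\},$$ $$w^{(0,1)}(u,z)=2\pi e^{-\pi i/6}u^{-2/3}\Big\{\mathrm{Ai}_1(u^{2/3}z)\int_\infty^zp(t)\mathrm{Ai}(u^{2/3}t)dt-\mathrm{Ai}(u^{2/3}z)\int_{\infty e^{2\pi i/3}}^zp(t)\mathrm{Ai}_1(u^{2/3}t)dt\Big\}.$$ Scaled Scorer functions: with $\mathrm{Hi}(x)=\frac1\pi\int_0^\infty\exp(-\frac13t^3+xt)dt$, $\mathrm{Wi}^{(-1,1)}(x)=\pi\mathrm{Hi}(x)$, $\mathrm{Wi}^{(0,1)}(x)=\pi e^{2\pi i/3}\mathrm{Hi}(xe^{2\pi i/3})$, $\mathrm{Wi}^{(-1,0)}(x)=\pi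 e^{-2\pi i/3}\mathrm{Hi}(xe^{-2\pi i/3})$. The function $\mathcal{G}(u,z)$ is the same for all three pairs $(j,k)$ and is defined by the first displayed formula of the claim. *)

(* Defs.v *)
From Stdlib Require Export Reals Factorial.
From Coquelicot Require Export Coquelicot.

Local Open Scope R_scope.
Local Open Scope C_scope.

Definition Cexp (z : C) : C :=
  (exp (Re z) * cos (Im z), exp (Re z) * sin (Im z))%R.

Definition cis (theta : R) : C := Cexp (Ci * theta).

(* [RInt_gen] is total; the integrals to which it is applied below all
   converge. *)
Definition Cint_0_infty (f : R -> C) : C :=
  RInt_gen (V := C_R_CompleteNormedModule) f (at_point 0)
    (Rbar_locally p_infty).

(* The contour integral of [f] from [infinity * e^(i theta)] to [z], taken
   along the half-line [{z + s e^(i theta) | s >= 0}].  The integrands below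
   are entire and decay superexponentially in a sector around the direction
   [theta], so that by Cauchy's theorem any other contour starting at infinity
   in that direction gives the same value. *)
Definition Cint_from_infty (theta : R) (f : C -> C) (z : C) : C :=
  - (cis theta * Cint_0_infty (fun s : R => f (z + s * cis theta))).

(* Ai(x) = 1/(2 pi i) int_(infty e^(-pi i/3))^(infty e^(pi i/3))
             exp(t^3/3 - x t) dt,
   the contour consisting of the two rays through the origin. *)
Definition Ai (x : C) : C :=
  let E := fun t : C => Cexp (t ^ 3 / 3 - x * t) in
  / (2 * PI * Ci) *
  (Cint_from_infty (- (PI / 3)) E 0 - Cint_from_infty (PI / 3) E 0).

Definition Ai_ (j : Z) (x : C) : C := Ai (x * cis (- (2 * PI * IZR j / 3))).

Definition Hi (x : C) : C :=
  / PI * Cint_0_infty (fun t : R => Cexp (- (t ^ 3 / 3) + x * t)).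

(* The pairs (j,k) with j, k in {-1, 0, 1} and j < k. *)
Inductive index_pair : Set := pair_m1_1 | pair_m1_0 | pair_0_1.

Definition Wi (jk : index_pair) (x : C) : C :=
  match jk with
  | pair_m1_1 => PI * Hi x
  | pair_0_1 => PI * cis (2 * PI / 3) * Hi (x * cis (2 * PI / 3))
  | pair_m1_0 => PI * cis (- (2 * PI / 3)) * Hi (x * cis (- (2 * PI / 3)))
  end.

(* The polynomial with coefficients [p 0, ..., p N]; the values of [p] beyond
   [N] are irrelevant. *)
Definition poly_eval (p : nat -> C) (N : nat) (z : C) : C :=
  sum_n (fun r => p r * z ^ r) N.

Definition w (p : nat -> C) (N : nat) (jk : index_pair) (u : R) (z : C) : C :=
  let a : R := Rpower u (2 / 3) in
  (* int_(infty e^(2 pi i j/3))^z p(t) Ai_j(u^(2/3) t) dt *)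
  let I (j : Z) : C :=
    Cint_from_infty (2 * PI * IZR j / 3)
      (fun t => poly_eval p N t * Ai_ j (a * t)) z in
  match jk with
  | pair_m1_1 =>
      2 * PI * Ci * Rpower u (- (2 / 3)) *
      (Ai_ (-1) (a * z) * I 1%Z - Ai_ 1 (a * z) * I (-1)%Z)
  | pair_m1_0 =>
      2 * PI * cis (PI / 6) * Rpower u (- (2 / 3)) *
      (Ai_ (-1) (a * z) * I 0%Z - Ai_ 0 (a * z) * I (-1)%Z)
  | pair_0_1 =>
      2 * PI * cis (- (PI / 6)) * Rpower u (- (2 / 3)) *
      (Ai_ 1 (a * z) * I 0%Z - Ai_ 0 (a * z) * I 1%Z)
  end.

(* [f] is an entire solution of f'' - u^2 z f = p(z), the derivatives being
   complex ones. *)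
Definition solves_inhomogeneous_airy
    (p : nat -> C) (N : nat) (u : R) (f : C -> C) : Prop :=
  exists f' f'' : C -> C,
    forall z : C,
      is_derive (K := C_AbsRing) (V := C_NormedModule) f z (f' z) /\
      is_derive (K := C_AbsRing) (V := C_NormedModule) f' z (f'' z) /\
      f'' z - u ^ 2 * z * f z = poly_eval p N z.

Definition gamma (p : nat -> C) (N : nat) (u : R) : C :=
  / Rpower u (4 / 3) *
  sum_n (fun s => INR (fact (3 * s)) * p (3 * s)%nat /
                  (3 ^ s * INR (fact s) * u ^ (2 * s))) (N / 3).

(* Only the values at [z <> 0] are meaningful; [z ^ r / z] stands for
   z^(r-1), which is z^(-1) when r = 0. *)
Fixpoint Ghat (p : nat -> C) (N : nat) (s : nat) (z : C) : C :=
  match s with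
  | O => - sum_n (fun r => p r * (z ^ r / z)) N
  | S s' => / z * C_derive (C_derive (Ghat p N s')) z
  end.

(* [g] is the regular part of the Laurent expansion at 0 of [f], a function
   on the punctured plane (the value [f 0] is irrelevant): for z <> 0,
     f z = g z + sum_(n >= 0) b_n / z^(n+1)  with  g z = sum_(n >= 0) a_n z^n.
   By uniqueness of Laurent expansions [f] determines [g]. *)
Definition is_regular_part (f g : C -> C) : Prop :=
  exists a b : nat -> C,
    (forall z : C, is_pseries (K := C_AbsRing) (V := C_NormedModule) a z (g z))
    /\
    (forall z : C, z <> 0 ->
       is_series (K := C_AbsRing) (V := C_NormedModule)
         (fun n => b n / z ^ (S n)) (f z - g z)).

(* Main.v *)
From Stdlib Require Import Lra Lia Psatz.
Require Import Defs.
Local Open Scope R_scope.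
Local Open Scope C_scope.

(** The theorem is an exact identity followed by a truncation.

    The operator [f'' - u^2 z f] maps [- z^(r-1) / u^2] to
    [z^r - (r-1)(r-2) z^(r-3) / u^2].  Iterating, every monomial [z^r] is
    reduced modulo the image of a polynomial to a constant, which is nonzero
    only if 3 divides [r].  So there is a polynomial [calG], a finite sum of the
    regular parts of the formal coefficients, with
    [calG'' - u^2 z calG = p - u^(4/3) gamma] ([calG_ode], [gamma_residue]).
    The function [Wi (u^(2/3) z)] takes care of the constant, because
    [Wi'' - x Wi = 1].  Hence [F = gamma Wi (u^(2/3) z) + calG] solves the
    equation, and truncating the finite sum [calG] leaves finitely many terms of
    order [u^(-2m-2)] or smaller, bounded uniformly on a disc
    ([calG_tail_bound]).

    What remains is [w = F].  If [A z = Ai_j (u^(2/3) z)], then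
    [(F' A - F A')' = p A], so each contour integral in [w] equals
    [F' A - F A'] at [z], provided that this expression vanishes at infinity
    in the direction in which [A] decays ([ray_integral]).  The combination of
    two such integrals that defines [w] is then [F] times a Wronskian
    ([variation_of_parameters]).  The vanishing at infinity holds for every
    solution of polynomial growth in the two directions of integration
    ([w_eq_moderate_solution]), and each [Wi] is bounded in the two directions
    that belong to its pair of indices.

    All facts about [Hi] and [Ai] come from the moments
    [M_k x = int_0^oo t^k exp (- t^3/3 + x t) dt].  One has [Hi = M_0 / PI], and
    since the contour defining [Ai] consists of two rays from the origin, [Ai] is
    a combination of [M_0] at the two rotated arguments
    ([Ai_eq_Ai_deriv_0]).  The moments satisfy [M_k' = M_(k+1)] and a three-term
    recurrence, and are bounded on half-planes.  Two points need an idea.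

    - The decay of [Ai] follows without a saddle point or a contour shift:
      the derivatives of [Ai] are bounded along the ray, and
      [x Ai^(k) = Ai^(k+2) - k Ai^(k-1)] gains one power of [x] at each use
      ([Ai_deriv_decay]).
    - The value of the Wronskians reduces to
      [M_0 0 * M_1 0 = 2 PI / (3 sqrt 3)], which is the reflection formula for
      [Gamma (1/3) Gamma (2/3)].  It is obtained like the Gaussian integral, by
      differentiating the product of two incomplete integrals
      ([incomplete_moment_product]). *)

(** * Complex-valued calculus *)

(** The target is taken to be [C_NormedModule], not [C_AbsRing] over itself:
    the two derivatives agree ([Cderiv_AbsRing]) but are not convertible, and
    the product rule is about the latter. *)
Definition Cderiv (f : C -> C) (z l : C) : Prop :=
  is_derive (K := C_AbsRing) (V := C_NormedModule) f z l.
Definition Rderiv (f : R -> C) (t : R) (l : C) : Prop :=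
  is_derive (K := R_AbsRing) (V := C_R_NormedModule) f t l.
Arguments Cderiv f%_function_scope z%_C_scope l%_C_scope.
Arguments Rderiv f%_function_scope t%_R_scope l%_C_scope.

Lemma Cplus_sub_cancel (z y : C) : z + (y - z) = y.
Proof. ring. Qed.

Lemma Cderiv_iff (f : C -> C) (z l : C) :
  Cderiv f z l <->
  forall eps : posreal, exists delta : posreal, forall h : C,
    (Cmod h < delta)%R ->
    (Cmod (f (z + h) - f z - h * l)%C <= eps * Cmod h)%R.
Proof.
  split.
  - intros [_ H] eps.
    destruct (H z (fun P HP => HP) eps) as [d Hd].
    exists d; intros h Hh.
    specialize (Hd (z + h)).
    change (Cmod (z + h - z)%C < d -> Cmod (f (z + h) - f z - (z + h - z) * l)%C <=
      eps * Cmod (z + h - z)%C)%R in Hd.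
    replace (z + h - z) with h in Hd by ring. now apply Hd.
  - intros H; split.
    + apply is_linear_scal_l.
    + intros y Hy eps.
      apply (is_filter_lim_locally_unique (V := AbsRing_NormedModule C_AbsRing)) in Hy.
      subst y.
      destruct (H eps) as [d Hd]. exists d. intros y Hy.
      change (Cmod (y - z)%C < d)%R in Hy.
      specialize (Hd (y - z) Hy).
      replace (z + (y - z)) with (y : C) in Hd by (symmetry; exact (Cplus_sub_cancel z y)).
      exact Hd.
Qed.

Lemma Rderiv_iff (f : R -> C) (t : R) (l : C) :
  Rderiv f t l <->
  forall eps : posreal, exists delta : posreal, forall h : R,
    (Rabs h < delta)%R ->
    (Cmod (f (t + h)%R - f t - h * l)%C <= eps * Rabs h)%R.
Proof.
  assert (EN : forall h, Cmod (f (t + h)%R - f t - h * l) =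
     norm (minus (minus (f (t + h)%R) (f t)) (scal h l) : C_R_NormedModule)).
  { intros h. rewrite scal_R_Cmult. apply Cmod_norm. }
  split.
  - intros [_ H] eps.
    destruct (H t (fun P HP => HP) eps) as [d Hd].
    exists d; intros h Hh.
    specialize (Hd (t + h)%R).
    change (Rabs (t + h - t) < d ->
      norm (minus (minus (f (t + h)%R) (f t)) (scal (t + h - t)%R l) : C_R_NormedModule)
      <= eps * Rabs (t + h - t))%R in Hd.
    replace (t + h - t)%R with h in Hd by ring. rewrite EN. now apply Hd.
  - intros H; split.
    + apply is_linear_scal_l.
    + intros y Hy eps.
      apply (is_filter_lim_locally_unique (V := AbsRing_NormedModule R_AbsRing)) in Hy.
      subst y.
      destruct (H eps) as [d Hd]. exists d. intros y Hy.
      change (Rabs (y - t) < d)%R in Hy.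
      specialize (Hd (y - t)%R Hy). rewrite EN in Hd.
      replace (t + (y - t))%R with (y : R) in Hd by (symmetry; exact (Rplus_minus t y)).
      exact Hd.
Qed.

Lemma Cderiv_AbsRing (f : C -> C) (z l : C) :
  is_derive (K := C_AbsRing) (V := AbsRing_NormedModule C_AbsRing) f z l <->
  Cderiv f z l.
Proof.
  split; intros [_ H].
  - split; [apply is_linear_scal_l | exact H].
  - split; [apply is_linear_scal_l | exact H].
Qed.

Lemma Cderiv_const (c z : C) : Cderiv (fun _ => c) z 0.
Proof. apply (is_derive_const (K := C_AbsRing) (V := C_NormedModule)). Qed.

Lemma Cderiv_id (z : C) : Cderiv (fun x => x) z 1.
Proof. apply Cderiv_AbsRing. exact (is_derive_id (K := C_AbsRing) z). Qed.

Lemma Cderiv_plus (f g : C -> C) (z a b : C) :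
  Cderiv f z a -> Cderiv g z b -> Cderiv (fun x => f x + g x) z (a + b).
Proof. apply (is_derive_plus (K := C_AbsRing) (V := C_NormedModule)). Qed.

Lemma Cderiv_opp (f : C -> C) (z a : C) :
  Cderiv f z a -> Cderiv (fun x => - f x) z (- a).
Proof. apply (is_derive_opp (K := C_AbsRing) (V := C_NormedModule)). Qed.

Lemma Cderiv_minus (f g : C -> C) (z a b : C) :
  Cderiv f z a -> Cderiv g z b -> Cderiv (fun x => f x - g x) z (a - b).
Proof. apply (is_derive_minus (K := C_AbsRing) (V := C_NormedModule)). Qed.

Lemma Cderiv_mult (f g : C -> C) (z a b : C) :
  Cderiv f z a -> Cderiv g z b ->
  Cderiv (fun x => f x * g x) z (a * g z + f z * b).
Proof.
  intros Hf%Cderiv_AbsRing Hg%Cderiv_AbsRing.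
  apply Cderiv_AbsRing.
  exact (is_derive_mult (K := C_AbsRing) f g z a b Hf Hg Cmult_comm).
Qed.

Lemma Cderiv_comp (f g : C -> C) (z a b : C) :
  Cderiv f (g z) a -> Cderiv g z b -> Cderiv (fun x => f (g x)) z (a * b).
Proof.
  intros Hf Hg%Cderiv_AbsRing. rewrite Cmult_comm.
  exact (is_derive_comp (K := C_AbsRing) (V := C_NormedModule) f g z a b Hf Hg).
Qed.

Lemma Cderiv_ext (f g : C -> C) (z l : C) :
  (forall x, f x = g x) -> Cderiv f z l -> Cderiv g z l.
Proof. apply (is_derive_ext (K := C_AbsRing) (V := C_NormedModule)). Qed.

Lemma Cderiv_eq (f : C -> C) (z l l' : C) :
  Cderiv f z l -> l = l' -> Cderiv f z l'.
Proof. now intros H <-. Qed.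

Lemma Cderiv_scal (c : C) (f : C -> C) (z a : C) :
  Cderiv f z a -> Cderiv (fun x => c * f x) z (c * a).
Proof.
  intros H. eapply Cderiv_eq.
  - apply Cderiv_mult; [apply Cderiv_const | exact H].
  - cbv beta; ring.
Qed.

Lemma Cderiv_pow (n : nat) (z : C) :
  Cderiv (fun x => x ^ n) z (INR n * z ^ (n - 1)).
Proof.
  induction n as [|n IH].
  - apply (Cderiv_ext (fun _ => 1)); [reflexivity|].
    apply (Cderiv_eq _ _ _ _ (Cderiv_const 1 z)). simpl. ring.
  - eapply Cderiv_eq.
    + eapply Cderiv_ext; [|apply Cderiv_mult; [apply Cderiv_id|exact IH]].
      intros x; simpl; reflexivity.
    + rewrite S_INR, RtoC_plus. replace (S n - 1)%nat with n by lia.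
      destruct n as [|n]; [simpl; ring|].
      replace (S n - 1)%nat with n by lia. rewrite Cpow_S. ring.
Qed.

Lemma Cderiv_sum_n (f d : nat -> C -> C) (N : nat) (z : C) :
  (forall k, (k <= N)%nat -> Cderiv (f k) z (d k z)) ->
  Cderiv (fun x => sum_n (fun k => f k x) N) z (sum_n (fun k => d k z) N).
Proof.
  apply (is_derive_sum_n (K := C_AbsRing) (V := C_NormedModule) f N z
           (fun k => d k z)).
Qed.

Lemma Rderiv_path (f : C -> C) (z c l : C) (t : R) :
  Cderiv f (z + t * c) l -> Rderiv (fun s : R => f (z + s * c)) t (c * l).
Proof.
  intros H. apply Rderiv_iff. intros eps.
  pose proof (proj1 (Cderiv_iff _ _ _) H) as H'.
  assert (Hc : (0 < Cmod c + 1)%R) by (pose proof (Cmod_ge_0 c); lra).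
  destruct (H' (mkposreal _ (Rdiv_lt_0_compat _ _ (cond_pos eps) Hc))) as [d Hd].
  exists (mkposreal _ (Rdiv_lt_0_compat _ _ (cond_pos d) Hc)).
  simpl in *. intros h Hh.
  assert (Hm : Cmod (h * c) = (Rabs h * Cmod c)%R) by (rewrite Cmod_mult, Cmod_R; reflexivity).
  pose proof (Rabs_pos h) as Hp. pose proof (Cmod_ge_0 c) as Hq.
  assert (Hb : (Rabs h * (Cmod c + 1) < d)%R).
  { apply (Rmult_lt_compat_r (Cmod c + 1)) in Hh; [|lra].
    unfold Rdiv in Hh. rewrite Rmult_assoc, Rinv_l in Hh; lra. }
  specialize (Hd (h * c)). rewrite Hm in Hd.
  replace (z + (t + h)%R * c) with (z + t * c + h * c) by (rewrite RtoC_plus; ring).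
  replace (h * (c * l)) with (h * c * l) by ring.
  eapply Rle_trans; [apply Hd; nra|].
  assert (Hr : (eps / (Cmod c + 1) * (Cmod c + 1) = eps)%R) by (field; lra).
  assert (0 < eps / (Cmod c + 1))%R by (apply Rdiv_lt_0_compat; [apply cond_pos|lra]).
  rewrite <- Hr at 2. nra.
Qed.

Lemma Rderiv_pair (f g : R -> R) (t a b : R) :
  is_derive f t a -> is_derive g t b ->
  Rderiv (fun s => (f s, g s) : C) t ((a, b) : C).
Proof.
  intros Hf Hg.
  pose proof (is_derive_scal_l (V := C_R_NormedModule) f t a ((1, 0)%R : C) Hf) as H1.
  pose proof (is_derive_scal_l (V := C_R_NormedModule) g t b ((0, 1)%R : C) Hg) as H2.
  pose proof (is_derive_plus (V := C_R_NormedModule) _ _ _ _ _ H1 H2) as H3.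
  assert (E : forall x y : R, plus (scal x ((1, 0)%R : C_R_NormedModule))
             (scal y ((0, 1)%R : C_R_NormedModule)) = (x, y)).
  { intros x y. rewrite !scal_R_Cmult.
    change (Cplus (Cmult x (1, 0)%R) (Cmult y (0, 1)%R) = (x, y)).
    unfold Cplus, Cmult, RtoC; simpl. f_equal; ring. }
  rewrite E in H3.
  eapply is_derive_ext; [|exact H3].
  intros s. apply E.
Qed.

Lemma Rderiv_continuous (f : R -> C) (t : R) (l : C) :
  Rderiv f t l -> continuous (U := C_UniformSpace) f t.
Proof.
  intros H.
  apply (ex_derive_continuous (K := R_AbsRing) (V := C_R_NormedModule) f t).
  now exists l.
Qed.

Definition Rcontinuous (f : R -> C) : Prop :=
  forall t : R, continuous (U := C_UniformSpace) f t.

Lemma FTC (f df : R -> C) (a b : R) :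
  (forall t : R, Rderiv f t (df t)) -> Rcontinuous df ->
  is_RInt (V := C_R_NormedModule) df a b (f b - f a).
Proof.
  intros H Hc.
  apply (is_RInt_derive (V := C_R_CompleteNormedModule) f df a b).
  - intros t _. apply H.
  - intros t _. apply Hc.
Qed.

Lemma mean_value_bound (f df : R -> C) (B : R) :
  (forall t : R, Rderiv f t (df t)) -> Rcontinuous df ->
  (forall t : R, (0 <= t <= 1)%R -> (Cmod (df t) <= B)%R) ->
  (Cmod (f 1%R - f 0%R)%C <= B)%R.
Proof.
  intros H Hc HB.
  rewrite (Cmod_norm (f 1%R - f 0%R)).
  replace B with ((1 - 0) * B)%R by ring.
  refine (norm_RInt_le_const (V := C_R_NormedModule) df 0 1 _ B _ _ _).
  - lra.
  - intros t Ht. pose proof (HB t Ht) as H1. rewrite Cmod_norm in H1. exact H1.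
  - now apply FTC.
Qed.

Lemma exp_le (a b : R) : (a <= b)%R -> (exp a <= exp b)%R.
Proof.
  intros [H| ->]; [now apply Rlt_le, exp_increasing | apply Rle_refl].
Qed.

Lemma Cexp_0 : Cexp 0 = 1.
Proof.
  unfold Cexp; simpl. rewrite exp_0, cos_0, sin_0. unfold RtoC. f_equal; ring.
Qed.

Lemma Cexp_plus (a b : C) : Cexp (a + b) = Cexp a * Cexp b.
Proof.
  unfold Cexp. rewrite re_plus, im_plus, exp_plus, cos_plus, sin_plus.
  unfold Cmult; simpl. f_equal; ring.
Qed.

Lemma Cmod_Cexp (z : C) : Cmod (Cexp z) = exp (Re z).
Proof.
  unfold Cmod, Cexp; simpl.
  transitivity (sqrt ((exp (Re z)) ^ 2 * ((sin (Im z))² + (cos (Im z))²))).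
  - f_equal. unfold Rsqr. ring.
  - rewrite sin2_cos2, Rmult_1_r. apply sqrt_pow2. apply Rlt_le, exp_pos.
Qed.

Lemma Rderiv_Cexp_line (w : C) (t : R) :
  Rderiv (fun s : R => Cexp (s * w)) t (w * Cexp (t * w)).
Proof.
  destruct w as [a b].
  assert (E : forall s : R, (exp (s * a) * cos (s * b), exp (s * a) * sin (s * b))%R
     = Cexp (s * (a, b))).
  { intros s. unfold Cexp, RtoC, Cmult; simpl.
    replace (s * a - 0 * b)%R with (s * a)%R by ring.
    replace (s * b + 0 * a)%R with (s * b)%R by ring. reflexivity. }
  eapply is_derive_ext; [exact E|].
  rewrite <- E.
  replace ((a, b) * (exp (t * a) * cos (t * b), exp (t * a) * sin (t * b))%R)
   with ((a * exp (t * a) * cos (t * b) - b * exp (t * a) * sin (t * b),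
          a * exp (t * a) * sin (t * b) + b * exp (t * a) * cos (t * b))%R : C)
   by (unfold Cmult; simpl; f_equal; ring).
  apply Rderiv_pair; auto_derive; trivial; ring.
Qed.

Lemma Cmod_Cexp_unit_segment (w : C) (t : R) : (0 <= t <= 1)%R ->
  (Cmod (Cexp (t * w)) <= exp (Cmod w))%R.
Proof.
  intros Ht. rewrite Cmod_Cexp, re_scal_l.
  apply exp_le. pose proof (re_le_Cmod w). pose proof (Rle_abs (Re w)).
  pose proof (Cmod_ge_0 w). nra.
Qed.

Lemma Rcontinuous_deriv (f df : R -> C) :
  (forall t : R, Rderiv f t (df t)) -> Rcontinuous f.
Proof. intros H t. exact (Rderiv_continuous _ _ _ (H t)). Qed.

Lemma Rderiv_const_mult (c : C) (f : R -> C) (t : R) (l : C) :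
  Rderiv f t l -> Rderiv (fun s => c * f s) t (c * l).
Proof.
  intros H. apply Rderiv_iff. intros eps.
  assert (Hc : (0 < Cmod c + 1)%R) by (pose proof (Cmod_ge_0 c); lra).
  destruct (proj1 (Rderiv_iff _ _ _) H
    (mkposreal _ (Rdiv_lt_0_compat _ _ (cond_pos eps) Hc))) as [d Hd].
  exists d. intros h Hh. specialize (Hd h Hh). simpl in Hd.
  replace (c * f (t + h)%R - c * f t - h * (c * l)) with
    (c * (f (t + h)%R - f t - h * l)) by ring.
  rewrite Cmod_mult. pose proof (Cmod_ge_0 c).
  assert (E : (eps * Rabs h = (Cmod c + 1) * (eps / (Cmod c + 1) * Rabs h))%R)
    by (field; lra).
  rewrite E.
  assert (0 <= eps / (Cmod c + 1) * Rabs h)%R.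
  { apply Rmult_le_pos; [|apply Rabs_pos].
    apply Rlt_le, Rdiv_lt_0_compat; [apply cond_pos|lra]. }
  pose proof (Cmod_ge_0 (f (t + h)%R - f t - h * l)). nra.
Qed.

Lemma Cexp_minus1_bound (w : C) : (Cmod (Cexp w - 1) <= Cmod w * exp (Cmod w))%R.
Proof.
  pose proof (mean_value_bound (fun s : R => Cexp (s * w))
    (fun t => w * Cexp (t * w)) (Cmod w * exp (Cmod w))) as H.
  simpl in H. rewrite Cmult_1_l, Cmult_0_l, Cexp_0 in H. apply H.
  - apply Rderiv_Cexp_line.
  - eapply Rcontinuous_deriv. intros t. apply Rderiv_const_mult, Rderiv_Cexp_line.
  - intros t Ht. rewrite Cmod_mult.
    apply Rmult_le_compat_l; [apply Cmod_ge_0|]. now apply Cmod_Cexp_unit_segment.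
Qed.

(** Mean value inequality for [s => Cexp (s w) - s w] on [[0, 1]], whose
    derivative is [w (Cexp (s w) - 1)]. *)
Lemma Cexp_taylor_bound (w : C) :
  (Cmod (Cexp w - 1 - w) <= Cmod w ^ 2 * exp (Cmod w))%R.
Proof.
  pose proof (mean_value_bound (fun s : R => Cexp (s * w) + - w * s)
    (fun t => w * Cexp (t * w) + - w) (Cmod w ^ 2 * exp (Cmod w))) as H.
  simpl in H. rewrite Cmult_1_l, Cmult_0_l, Cexp_0 in H.
  replace (Cexp w - 1 - w) with (Cexp w + - w * 1 - (1 + - w * 0)) by ring.
  assert (Hid : forall t : R, Rderiv (fun s : R => - w * s) t (- w)).
  { intros t.
    pose proof (Rderiv_path (fun z => - w * z) 0 1 (-w) t) as Hp.
    rewrite Cmult_1_l in Hp.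
    eapply is_derive_ext; [|apply Hp].
    - intros s. simpl. ring.
    - apply (Cderiv_eq _ _ (- w * 1)); [|ring].
      apply Cderiv_scal, Cderiv_id. }
  apply H.
  - intros t. apply (is_derive_plus (K := R_AbsRing) (V := C_R_NormedModule)).
    + apply Rderiv_Cexp_line.
    + apply Hid.
  - eapply Rcontinuous_deriv. intros t.
    apply (is_derive_plus (K := R_AbsRing) (V := C_R_NormedModule)).
    + apply Rderiv_const_mult, Rderiv_Cexp_line.
    + apply (is_derive_const (K := R_AbsRing) (V := C_R_NormedModule)).
  - intros t Ht.
    replace (w * Cexp (t * w) + - w) with (w * (Cexp (t * w) - 1)) by ring.
    rewrite Cmod_mult, Rmult_1_r, Rmult_assoc.
    apply Rmult_le_compat_l; [apply Cmod_ge_0|].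
    eapply Rle_trans; [apply Cexp_minus1_bound|].
    assert (Hm : (Cmod (t * w) <= Cmod w)%R).
    { rewrite Cmod_mult, Cmod_R, Rabs_pos_eq by lra.
      pose proof (Cmod_ge_0 w). nra. }
    apply Rmult_le_compat; [apply Cmod_ge_0|apply Rlt_le, exp_pos|exact Hm|].
    now apply exp_le.
Qed.

Lemma Cderiv_Cexp (z : C) : Cderiv Cexp z (Cexp z).
Proof.
  apply Cderiv_iff. intros eps.
  set (A := (Cmod (Cexp z) * exp 1)%R).
  assert (HA : (0 < A + 1)%R).
  { assert (0 <= A)%R by (apply Rmult_le_pos; [apply Cmod_ge_0|apply Rlt_le, exp_pos]). lra. }
  assert (Hm : (0 < Rmin 1 (eps / (A + 1)))%R).
  { apply Rmin_glb_lt; [lra|]. apply Rdiv_lt_0_compat; [apply cond_pos|lra]. }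
  exists (mkposreal _ Hm). simpl. intros h Hh.
  pose proof (Rmin_l 1 (eps / (A + 1))). pose proof (Rmin_r 1 (eps / (A + 1))).
  rewrite Cexp_plus.
  replace (Cexp z * Cexp h - Cexp z - h * Cexp z) with
    (Cexp z * (Cexp h - 1 - h)) by ring.
  rewrite Cmod_mult.
  pose proof (Cexp_taylor_bound h) as Ht.
  pose proof (Cmod_ge_0 h) as Hh0. pose proof (Cmod_ge_0 (Cexp z)) as Hz0.
  assert (He : (exp (Cmod h) <= exp 1)%R) by (apply exp_le; lra).
  assert (Hd : ((A + 1) * Cmod h <= eps)%R).
  { apply Rle_trans with ((A + 1) * (eps / (A + 1)))%R.
    - apply Rmult_le_compat_l; lra.
    - right. field. lra. }
  apply Rle_trans with (Cmod (Cexp z) * (Cmod h ^ 2 * exp 1))%R.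
  { apply Rmult_le_compat_l; [lra|]. eapply Rle_trans; [exact Ht|].
    apply Rmult_le_compat_l; [nra|exact He]. }
  replace (Cmod (Cexp z) * (Cmod h ^ 2 * exp 1))%R with (A * Cmod h * Cmod h)%R
    by (unfold A; ring).
  nra.
Qed.

(** * Improper integrals of complex-valued functions *)

Definition is_Cint (f : R -> C) (l : C) : Prop :=
  is_RInt_gen (V := C_R_NormedModule) f (at_point 0) (Rbar_locally p_infty) l.

Lemma is_Cint_unique (f : R -> C) (l : C) : is_Cint f l -> Cint_0_infty f = l.
Proof.
  intros H. unfold Cint_0_infty.
  exact (is_RInt_gen_unique (V := C_R_CompleteNormedModule) f l H).
Qed.

Lemma is_Cint_intro (f F : R -> C) (l : C) :
  (forall b : R, is_RInt (V := C_R_NormedModule) f 0 b (F b)) ->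
  (forall eps : R, (0 < eps)%R -> exists T : R, forall b : R, (T < b)%R ->
     (Cmod (F b - l)%C < eps)%R) ->
  is_Cint f l.
Proof.
  intros HF Hl P [eps HP].
  destruct (Hl eps (cond_pos eps)) as [T HT].
  exists (fun a => a = 0%R) (fun b => (T < b)%R).
  - reflexivity.
  - now exists T.
  - intros a b -> Hb. exists (F b). split; [apply HF|].
    apply HP. apply C_NormedModule_mixin_compat1. exact (HT b Hb).
Qed.

Lemma is_Cint_FTC (f df : R -> C) (l : C) :
  (forall t : R, Rderiv f t (df t)) -> Rcontinuous df ->
  (forall eps : R, (0 < eps)%R -> exists T : R, forall b : R, (T < b)%R ->
     (Cmod (f b - l)%C < eps)%R) ->
  is_Cint df (l - f 0%R).
Proof.
  intros Hd Hc Hl. apply (is_Cint_intro _ (fun b => f b - f 0%R)).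
  - intros b. now apply FTC.
  - intros eps He. destruct (Hl eps He) as [T HT]. exists T. intros b Hb.
    replace (f b - f 0%R - (l - f 0%R)) with (f b - l) by ring. now apply HT.
Qed.

Lemma is_Cint_ext (f g : R -> C) (l : C) :
  (forall t : R, f t = g t) -> is_Cint f l -> is_Cint g l.
Proof.
  intros H. apply is_RInt_gen_ext.
  exists (fun _ => True) (fun _ => True).
  - exact I.
  - now exists 0%R.
  - intros a b _ _ x _. apply H.
Qed.

Lemma is_Cint_plus (f g : R -> C) (a b : C) :
  is_Cint f a -> is_Cint g b -> is_Cint (fun t => f t + g t) (a + b).
Proof.
  exact (is_RInt_gen_plus (V := C_R_NormedModule) (Fa := at_point 0)
    (Fb := Rbar_locally p_infty) f g a b).
Qed.

(** Complex factors do not act on [C] as a real module, so the factor is split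
    into real and imaginary parts, and multiplication by [Ci] is treated on
    components. *)
Lemma is_Cint_scal (c : C) (f : R -> C) (a : C) :
  is_Cint f a -> is_Cint (fun t => c * f t) (c * a).
Proof.
  destruct c as [c d].
  intros H.
  assert (HJ : is_Cint (fun t => Ci * f t) (Ci * a)).
  { intros P HP.
    assert (HP' : locally (a : C_R_NormedModule) (fun y => P (Ci * y))).
    { destruct HP as [eps HP]. exists eps. intros [y1 y2] Hy. apply HP.
      destruct a as [a1 a2]. destruct Hy as [Hy1 Hy2].
      change (Rabs (y1 - a1) < eps)%R in Hy1. change (Rabs (y2 - a2) < eps)%R in Hy2.
      split.
      - change (Rabs ((0 * y1 - 1 * y2) - (0 * a1 - 1 * a2)) < eps)%R.
        replace ((0 * y1 - 1 * y2) - (0 * a1 - 1 * a2))%R with (- (y2 - a2))%R by ring.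
        now rewrite Rabs_Ropp.
      - change (Rabs ((0 * y2 + 1 * y1) - (0 * a2 + 1 * a1)) < eps)%R.
        now replace ((0 * y2 + 1 * y1) - (0 * a2 + 1 * a1))%R with (y1 - a1)%R by ring. }
    destruct (H _ HP') as [Q S HQ HS HQS].
    exists Q S; trivial. intros x y Hx Hy.
    destruct (HQS x y Hx Hy) as [v [Hv Pv]].
    exists (Ci * v). split; [|exact Pv].
    clear - Hv. simpl in *.
    destruct v as [v1 v2].
    assert (H1 := is_RInt_fct_extend_fst (U := R_NormedModule) (V := R_NormedModule) _ _ _ _ Hv).
    assert (H2 := is_RInt_fct_extend_snd (U := R_NormedModule) (V := R_NormedModule) _ _ _ _ Hv).
    apply (is_RInt_ext (V := C_R_NormedModule) (fun t => ((- snd (f t))%R, fst (f t)) : C)).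
    { intros t _. unfold Ci, Cmult; simpl. f_equal; ring. }
    replace (Ci * (v1, v2)) with ((- v2)%R, v1) by (unfold Ci, Cmult; simpl; f_equal; ring).
    apply (is_RInt_fct_extend_pair (U := R_NormedModule) (V := R_NormedModule)).
    - simpl. apply (is_RInt_opp (V := R_NormedModule) (fun t => snd (f t))). exact H2.
    - exact H1. }
  assert (HR : forall (r : R) (g : R -> C) (v : C), is_Cint g v ->
            is_Cint (fun t => r * g t) (r * v)).
  { intros r g v Hg.
    apply (is_Cint_ext (fun t => scal r (g t : C_R_NormedModule))).
    { intros t. now rewrite scal_R_Cmult. }
    rewrite <- scal_R_Cmult.
    exact (is_RInt_gen_scal (V := C_R_NormedModule) (Fa := at_point 0)
      (Fb := Rbar_locally p_infty) g r v Hg). }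
  apply (is_Cint_ext (fun t => c * f t + d * (Ci * f t))).
  { intros t. unfold RtoC, Ci, Cplus, Cmult; simpl. f_equal; ring. }
  replace ((c, d) * a) with (c * a + d * (Ci * a))
    by (unfold RtoC, Ci, Cplus, Cmult; simpl; f_equal; ring).
  apply is_Cint_plus; apply HR; assumption.
Qed.

Lemma is_RInt_exp_neg (B a b : R) :
  is_RInt (fun t : R => B * exp (- t))%R a b (B * exp (- a) - B * exp (- b))%R.
Proof.
  replace (B * exp (- a) - B * exp (- b))%R
    with (minus ((fun t : R => - B * exp (- t))%R b) ((fun t : R => - B * exp (- t))%R a))
    by (unfold minus, plus, opp; simpl; ring).
  apply (is_RInt_derive (V := R_CompleteNormedModule)
    (fun t : R => - B * exp (- t))%R (fun t : R => B * exp (- t))%R).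
  - intros t _. auto_derive; trivial. ring.
  - intros t _. apply (ex_derive_continuous (V := R_NormedModule)). auto_derive. trivial.
Qed.

Lemma exp_neg_small (B eps : R) : (0 <= B)%R -> (0 < eps)%R ->
  exists T : R, (0 <= T)%R /\ forall t : R, (T < t)%R -> (B * exp (- t) < eps)%R.
Proof.
  intros HB He. exists (B / eps)%R. split.
  { apply Rdiv_le_0_compat; lra. }
  intros t Ht.
  assert (Hq : (0 <= B / eps)%R) by (apply Rdiv_le_0_compat; lra).
  pose proof (exp_ineq1_le t) as H1.
  rewrite exp_Ropp. pose proof (exp_pos t).
  apply (Rmult_lt_reg_r (exp t)); [assumption|].
  rewrite Rmult_assoc, Rinv_l by lra.
  assert (B < eps * t)%R.
  { apply (Rmult_lt_compat_l eps) in Ht; [|lra].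
    replace (eps * (B / eps))%R with B in Ht by (field; lra). exact Ht. }
  nra.
Qed.

Lemma dominated_tail (f : R -> C) (B a b : R) (l : C) :
  (forall t : R, (0 <= t)%R -> (Cmod (f t) <= B * exp (- t))%R) ->
  (0 <= a <= b)%R -> is_RInt (V := C_R_NormedModule) f a b l ->
  (Cmod l <= B * exp (- a) - B * exp (- b))%R.
Proof.
  intros HB Hab Hl. rewrite Cmod_norm.
  refine (norm_RInt_le (V := C_R_NormedModule) f (fun t => B * exp (- t))%R a b l _ _ _ Hl _).
  - lra.
  - intros t Ht. pose proof (HB t) as H1. rewrite Cmod_norm in H1. apply H1. lra.
  - apply is_RInt_exp_neg.
Qed.

(** Domination by [B exp (- t)] suffices for all the integrals needed, and it
    makes both the Cauchy criterion and the bound explicit; the bound has the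
    same constant [B] because [exp (- t)] has integral 1. *)
Lemma dominated_convergent (f : R -> C) (B : R) :
  Rcontinuous f ->
  (forall t : R, (0 <= t)%R -> (Cmod (f t) <= B * exp (- t))%R) ->
  is_Cint f (Cint_0_infty f) /\ (Cmod (Cint_0_infty f) <= B)%R.
Proof.
  intros Hc HB.
  assert (HB0 : (0 <= B)%R).
  { pose proof (HB 0%R (Rle_refl 0)) as H. rewrite Ropp_0, exp_0, Rmult_1_r in H.
    pose proof (Cmod_ge_0 (f 0%R)). lra. }
  assert (HFe : exists F : R -> C, forall b : R,
    is_RInt (V := C_R_NormedModule) f 0 b (F b)).
  { exists (fun b : R => RInt (V := C_R_CompleteNormedModule) f 0 b).
    intros b. apply (RInt_correct (V := C_R_CompleteNormedModule)).
    apply ex_RInt_continuous. intros t _. apply Hc. }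
  destruct HFe as [F HF0].
  assert (HF : forall a b : R, is_RInt (V := C_R_NormedModule) f a b (F b - F a)).
  {intros a b.
    pose proof (is_RInt_swap (V := C_R_NormedModule) _ _ _ _ (HF0 a)) as H1.
    pose proof (is_RInt_Chasles (V := C_R_NormedModule) _ _ _ _ _ _ H1 (HF0 b)) as H2.
    replace (F b - F a) with (plus (opp (F a) : C_R_NormedModule) (F b : C_R_NormedModule)); [exact H2|].
    exact (Cplus_comm (- F a) (F b)). }
  assert (HF00 : F 0%R = 0).
  { pose proof (HF 0%R 0%R) as H1. replace (F 0%R - F 0%R) with (RtoC 0) in H1 by ring.
    pose proof (is_RInt_unique (V := C_R_CompleteNormedModule) _ _ _ _ (HF0 0%R)) as H2.
    pose proof (is_RInt_unique (V := C_R_CompleteNormedModule) _ _ _ _ H1) as H3.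
    congruence. }
  assert (HC : exists l : C, filterlim F (Rbar_locally p_infty)
     (locally (l : C_R_CompleteNormedModule))).
  { apply (filterlim_locally_cauchy (U := C_R_CompleteNormedModule)).
    intros eps. destruct (exp_neg_small B eps HB0 (cond_pos eps)) as [T [HT0 HT]].
    exists (fun b => (T < b)%R). split; [now exists T|].
    assert (Hle : forall a b : R, (T < a)%R -> (a <= b)%R -> (Cmod (F b - F a)%C < eps)%R).
    { intros a b Ha Hab.
      eapply Rle_lt_trans; [apply (dominated_tail f B a b); [exact HB|lra|apply HF]|].
      pose proof (HT a Ha). pose proof (exp_pos (- b)). nra. }
    intros a b Ha Hb.
    apply C_NormedModule_mixin_compat1.
    change (Cmod (F b - F a)%C < eps)%R.
    destruct (Rle_dec a b) as [H|H]; [now apply Hle|].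
    replace (F b - F a) with (- (F a - F b)) by ring. rewrite Cmod_opp.
    apply Hle; lra. }
  destruct HC as [l Hl].
  assert (Hlim : forall eps : R, (0 < eps)%R -> exists T : R, forall b : R, (T < b)%R ->
     (Cmod (F b - l)%C < eps)%R).
  { intros eps He.
    assert (He2 : (0 < eps / sqrt 2)%R) by (apply Rdiv_lt_0_compat; [lra|apply Rlt_sqrt2_0]).
    destruct (Hl _ (locally_ball (l : C_UniformSpace) (mkposreal _ He2))) as [T HT].
    exists T. intros b Hb. specialize (HT b Hb).
    apply (C_NormedModule_mixin_compat2 (l : C) (F b)) in HT. simpl in HT.
    replace (sqrt 2 * (eps / sqrt 2))%R with eps in HT.
    - exact HT.
    - field. pose proof Rlt_sqrt2_0. lra. }
  assert (HI : is_Cint f l).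
  { apply (is_Cint_intro f F); [|exact Hlim].
    intros b. pose proof (HF 0%R b) as H. rewrite HF00 in H.
    replace (F b - 0) with (F b) in H by ring. exact H. }
  rewrite (is_Cint_unique f l HI). split; [exact HI|].
  apply Rnot_lt_le. intros Hlt.
  destruct (Hlim (Cmod l - B)%R) as [T HT]; [lra|].
  set (b := (Rmax T 0 + 1)%R).
  assert (Hb : (T < b /\ 0 < b)%R).
  { unfold b. pose proof (Rmax_l T 0). pose proof (Rmax_r T 0). lra. }
  specialize (HT b (proj1 Hb)).
  pose proof (dominated_tail f B 0 b _ HB ltac:(lra) (HF 0%R b)) as H1.
  rewrite HF00 in H1. replace (F b - 0) with (F b) in H1 by ring.
  rewrite Ropp_0, exp_0 in H1. pose proof (exp_pos (- b)).
  pose proof (Cmod_triangle (F b) (- (F b - l))) as H2.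
  replace (F b + - (F b - l)) with (l : C) in H2 by ring. rewrite Cmod_opp in H2.
  nra.
Qed.

(** * The moments of the Scorer kernel *)

(** The variable [t] is complex so that the calculus rules for complex
    derivatives apply to the integrand; it is only integrated over real [t]. *)
Definition kernel (k : nat) (x t : C) : C :=
  t ^ k * Cexp (- (t ^ 3 / 3) + x * t).

Definition moment (k : nat) (x : C) : C :=
  Cint_0_infty (fun t : R => kernel k x t).

Lemma Cderiv_kernel (k : nat) (x t : C) :
  Cderiv (kernel k x) t
    (INR k * kernel (k - 1) x t + x * kernel k x t - kernel (S (S k)) x t).
Proof.
  unfold kernel.
  eapply Cderiv_eq.
  - apply Cderiv_mult; [apply Cderiv_pow|].
    apply (Cderiv_comp Cexp (fun t => - (t ^ 3 / 3) + x * t));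
      [apply Cderiv_Cexp|].
    apply Cderiv_plus.
    + apply Cderiv_opp. apply (Cderiv_ext (fun t => / 3 * t ^ 3)).
      { intros s. unfold Cdiv. ring. }
      apply Cderiv_scal, Cderiv_pow.
    + apply Cderiv_scal, Cderiv_id.
  - cbv beta. simpl INR. rewrite !Cpow_S. simpl Nat.sub.
    rewrite !RtoC_plus. field.
Qed.

Lemma Rderiv_kernel (k : nat) (x : C) (t : R) :
  Rderiv (fun s : R => kernel k x s) t
    (INR k * kernel (k - 1) x t + x * kernel k x t - kernel (S (S k)) x t).
Proof.
  pose proof (Rderiv_path (kernel k x) 0 1 _ t (Cderiv_kernel k x _)) as H.
  rewrite Cmult_1_l in H.
  replace (0 + t * 1) with (RtoC t) in H by ring.
  eapply is_derive_ext; [|exact H].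
  intros s. simpl. now replace (0 + s * 1) with (RtoC s) by ring.
Qed.

Lemma Rcontinuous_plus (f g : R -> C) :
  Rcontinuous f -> Rcontinuous g -> Rcontinuous (fun t => f t + g t).
Proof.
  intros Hf Hg t.
  exact (continuous_plus (V := C_R_NormedModule) f g t (Hf t) (Hg t)).
Qed.

Lemma Rcontinuous_kernel (k : nat) (x : C) : Rcontinuous (fun t : R => kernel k x t).
Proof. intros t. eapply Rderiv_continuous, Rderiv_kernel. Qed.

Lemma Rcontinuous_path (f df : C -> C) (z c : C) :
  (forall w : C, Cderiv f w (df w)) -> Rcontinuous (fun s : R => f (z + s * c)).
Proof. intros H t. eapply Rderiv_continuous, Rderiv_path, H. Qed.

Lemma Rcontinuous_scal (c : C) (f : R -> C) :
  Rcontinuous f -> Rcontinuous (fun t => c * f t).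
Proof.
  intros Hf t.
  apply (continuous_comp (U := R_UniformSpace) (V := C_UniformSpace) (W := C_UniformSpace)
    f (fun z => c * z) t (Hf t)).
  assert (H : Cderiv (fun z => c * z) (f t) (c * 1)) by apply Cderiv_scal, Cderiv_id.
  pose proof (ex_derive_continuous (K := C_AbsRing) (V := C_NormedModule)
    (fun z => c * z) (f t) (ex_intro _ _ H)) as Hc.
  intros P HP. specialize (Hc P HP).
  apply locally_C. exact Hc.
Qed.

Lemma exp_pow (n : nat) (t : R) : (exp t ^ n = exp (INR n * t))%R.
Proof.
  induction n as [|n IH].
  - simpl. now rewrite Rmult_0_l, exp_0.
  - rewrite S_INR. simpl. rewrite IH, <- exp_plus. f_equal. ring.
Qed.

Lemma Cmod_kernel (k : nat) (x : C) (t : R) : (0 <= t)%R ->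
  Cmod (kernel k x t) = (t ^ k * exp (- (t ^ 3 / 3) + Re x * t))%R.
Proof.
  intros Ht. unfold kernel. rewrite Cmod_mult, Cmod_pow, Cmod_R, Cmod_Cexp.
  rewrite Rabs_pos_eq by assumption. f_equal. f_equal.
  rewrite re_plus, re_scal_r, re_opp. f_equal. f_equal.
  rewrite <- RtoC_pow, <- RtoC_div by lra. reflexivity.
Qed.

(** The cubic term beats any linear one: [c t - t^3/3] is at most [c (1 + 3 c)]
    for [t >= 0], [c >= 0], and [t^k <= exp (k t)]. *)
Lemma kernel_bound (k : nat) (rho : R) :
  exists B : R, forall (x : C) (t : R), (Re x <= rho)%R -> (0 <= t)%R ->
    (Cmod (kernel k x t) <= B * exp (- t))%R.
Proof.
  (* [Rabs rho] from the factor [exp (x t)], 1 from [exp (- t)] on the right-hand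
     side, [INR k] from [t^k <= exp (k t)] *)
  set (c := (Rabs rho + 1 + INR k)%R).
  exists (exp (c * (1 + 3 * c))). intros x t Hx Ht.
  rewrite Cmod_kernel by assumption.
  rewrite <- exp_plus.
  apply Rle_trans with (exp (INR k * t) * exp (- (t ^ 3 / 3) + Re x * t))%R.
  - apply Rmult_le_compat_r; [apply Rlt_le, exp_pos|].
    rewrite <- exp_pow. apply pow_incr. split; [assumption|].
    pose proof (exp_ineq1_le t). lra.
  - rewrite <- exp_plus. apply exp_le.
    assert (Hc : (1 <= c)%R).
    { unfold c. pose proof (Rabs_pos rho). pose proof (pos_INR k). lra. }
    assert (Hr : (Re x * t <= Rabs rho * t)%R).
    { apply Rmult_le_compat_r; [assumption|]. pose proof (Rle_abs rho). lra. }
    assert (Hm : (c * t - t ^ 3 / 3 <= c * (1 + 3 * c))%R).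
    { destruct (Rle_dec (3 * c) (t ^ 2)) as [H|H].
      - assert (0 <= t * (t ^ 2 - 3 * c))%R by (apply Rmult_le_pos; lra).
        assert (0 <= c * (1 + 3 * c))%R by nra. nra.
      - assert (t <= 1 + 3 * c)%R by nra.
        assert (0 <= t ^ 3)%R by (apply pow_le; assumption). nra. }
    unfold c in Hm |- *. lra.
Qed.

Lemma is_Cint_moment (k : nat) (x : C) :
  is_Cint (fun t : R => kernel k x t) (moment k x).
Proof.
  destruct (kernel_bound k (Re x)) as [B HB].
  apply (dominated_convergent _ B).
  - apply Rcontinuous_kernel.
  - intros t Ht. apply HB; [apply Rle_refl|exact Ht].
Qed.

Lemma moment_bound (k : nat) (rho : R) :
  exists B : R, forall x : C, (Re x <= rho)%R -> (Cmod (moment k x) <= B)%R.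
Proof.
  destruct (kernel_bound k rho) as [B HB].
  exists B. intros x Hx. unfold moment.
  apply (dominated_convergent _ B).
  - apply Rcontinuous_kernel.
  - intros t Ht. now apply HB.
Qed.

(** Differentiation under the integral sign with an explicit quadratic
    remainder: for [|h| <= 1],
    [|exp (h t) - 1 - h t| <= |h|^2 t^2 exp t], and the factor [t^2 exp t] turns
    the modulus of [kernel k x t] into that of [kernel (k + 2) (x + 1) t]. *)
Lemma Cderiv_moment (k : nat) (x : C) : Cderiv (moment k) x (moment (S k) x).
Proof.
  destruct (kernel_bound (S (S k)) (Re x + 1)) as [B HB].
  assert (HB0 : (0 <= B)%R).
  { pose proof (HB x 0%R ltac:(lra) (Rle_refl 0)) as H.
    rewrite Ropp_0, exp_0, Rmult_1_r in H.
    eapply Rle_trans; [apply Cmod_ge_0|exact H]. }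
  apply Cderiv_iff. intros eps.
  assert (Hm : (0 < Rmin 1 (eps / (B + 1)))%R).
  { apply Rmin_glb_lt; [lra|]. apply Rdiv_lt_0_compat; [apply cond_pos|lra]. }
  exists (mkposreal _ Hm). simpl. intros h Hh.
  pose proof (Rmin_l 1 (eps / (B + 1))). pose proof (Rmin_r 1 (eps / (B + 1))).
  pose proof (Cmod_ge_0 h) as Hh0.
  set (g := fun t : R => kernel k (x + h) t + (- (1)) * kernel k x t
                         + (- h) * kernel (S k) x t).
  assert (HI : is_Cint g (moment k (x + h) + (- (1)) * moment k x
                          + (- h) * moment (S k) x)).
  { apply is_Cint_plus; [apply is_Cint_plus|].
    - apply is_Cint_moment.
    - apply is_Cint_scal, is_Cint_moment.
    - apply is_Cint_scal, is_Cint_moment. }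
  replace (moment k (x + h) - moment k x - h * moment (S k) x) with
    (moment k (x + h) + (- (1)) * moment k x + (- h) * moment (S k) x) by ring.
  rewrite <- (is_Cint_unique _ _ HI).
  apply Rle_trans with (Cmod h ^ 2 * B)%R.
  - apply dominated_convergent.
    + apply Rcontinuous_plus; [apply Rcontinuous_plus|].
      * apply Rcontinuous_kernel.
      * apply Rcontinuous_scal, Rcontinuous_kernel.
      * apply Rcontinuous_scal, Rcontinuous_kernel.
    + intros t Ht.
      replace (g t) with (kernel k x t * (Cexp (h * t) - 1 - h * t)).
      2:{ unfold g, kernel.
          replace (- (t ^ 3 / 3) + (x + h) * t) with (- (t ^ 3 / 3) + x * t + h * t)
            by ring.
          rewrite (Cexp_plus (- (t ^ 3 / 3) + x * t)), (Cpow_S t k). ring. }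
      rewrite Cmod_mult, Rmult_assoc.
      assert (Hht : Cmod (h * t) = (Cmod h * t)%R).
      { rewrite Cmod_mult, Cmod_R, Rabs_pos_eq by assumption. reflexivity. }
      pose proof (Cexp_taylor_bound (h * t)) as HT. rewrite Hht in HT.
      pose proof (HB (x + 1) t) as HB1.
      rewrite re_plus, re_RtoC in HB1.
      specialize (HB1 (Rle_refl _) Ht).
      rewrite Cmod_kernel in HB1 |- * by assumption.
      rewrite re_plus, re_RtoC in HB1.
      assert (Hk : (0 <= t ^ k * exp (- (t ^ 3 / 3) + Re x * t))%R).
      { apply Rmult_le_pos; [now apply pow_le|apply Rlt_le, exp_pos]. }
      apply Rle_trans with
        (t ^ k * exp (- (t ^ 3 / 3) + Re x * t) * ((Cmod h * t) ^ 2 * exp t))%R.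
      * apply Rmult_le_compat_l; [exact Hk|].
        eapply Rle_trans; [exact HT|].
        apply Rmult_le_compat_l; [apply pow2_ge_0|].
        apply exp_le. nra.
      * replace (- (t ^ 3 / 3) + (Re x + 1) * t)%R with
          (- (t ^ 3 / 3) + Re x * t + t)%R in HB1 by ring.
        rewrite (exp_plus _ t) in HB1. simpl pow in HB1 |- *.
        apply Rle_trans with (Cmod h ^ 2 * (t * (t * t ^ k) *
          (exp (- (t * (t * (t * 1)) / 3) + Re x * t) * exp t)))%R.
        { right. ring. }
        simpl pow. apply Rmult_le_compat_l; [nra|exact HB1].
  - assert (Hd : ((B + 1) * Cmod h <= eps)%R).
    { apply Rle_trans with ((B + 1) * (eps / (B + 1)))%R.
      - apply Rmult_le_compat_l; lra.
      - right. field. lra. }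
    nra.
Qed.

(** Integral of the derivative of [kernel k x] over the half-line.  The boundary
    term at 0 is [0 ^ k], that is, 1 for [k = 0] and 0 otherwise; for [k = 0] it
    makes [Hi] a solution of the inhomogeneous equation. *)
Lemma moment_rec (k : nat) (x : C) :
  moment (S (S k)) x =
  x * moment k x + INR k * moment (k - 1) x + 0 ^ k.
Proof.
  assert (H1 : is_Cint (fun t : R => INR k * kernel (k - 1) x t + x * kernel k x t
                 - kernel (S (S k)) x t) (0 - kernel k x 0%R)).
  { apply (is_Cint_FTC (fun t : R => kernel k x t)).
    - intros t. apply Rderiv_kernel.
    - intros t. apply (continuous_minus (V := C_R_NormedModule)
        (fun t : R => INR k * kernel (k - 1) x t + x * kernel k x t)
        (fun t : R => kernel (S (S k)) x t)).
      + apply Rcontinuous_plus; apply Rcontinuous_scal, Rcontinuous_kernel.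
      + apply Rcontinuous_kernel.
    - intros eps He. destruct (kernel_bound k (Re x)) as [B HB].
      assert (HB0 : (0 <= B)%R).
      { pose proof (HB x 0%R ltac:(lra) (Rle_refl 0)) as H.
        rewrite Ropp_0, exp_0, Rmult_1_r in H.
        eapply Rle_trans; [apply Cmod_ge_0|exact H]. }
      destruct (exp_neg_small B eps HB0 He) as [T [HT0 HT]].
      exists T. intros t Ht.
      replace (kernel k x t - 0) with (kernel k x t) by ring.
      eapply Rle_lt_trans; [apply HB; lra|]. now apply HT. }
  assert (H2 : is_Cint (fun t : R => INR k * kernel (k - 1) x t + x * kernel k x t
                 - kernel (S (S k)) x t)
     (INR k * moment (k - 1) x + x * moment k x + - (1) * moment (S (S k)) x)).
  { apply (is_Cint_ext (fun t : R => INR k * kernel (k - 1) x t + x * kernel k x t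
                 + - (1) * kernel (S (S k)) x t)).
    { intros t. ring. }
    apply is_Cint_plus; [apply is_Cint_plus|]; apply is_Cint_scal, is_Cint_moment. }
  apply is_Cint_unique in H1. apply is_Cint_unique in H2.
  rewrite H1 in H2.
  replace (kernel k x 0%R) with (0 ^ k) in H2.
  - transitivity (x * moment k x + INR k * moment (k - 1) x +
      - (0 - 0 ^ k)); [|ring].
    rewrite H2. ring.
  - unfold kernel. replace (- (0 ^ 3 / 3) + x * 0) with (RtoC 0).
    + rewrite Cexp_0. ring.
    + simpl. unfold Cdiv. ring.
Qed.

Lemma Hi_moment (x : C) : Hi x = / PI * moment 0 x.
Proof.
  unfold Hi. apply (f_equal (Cmult (/ PI))).
  apply (is_Cint_unique (fun t : R => Cexp (- (t ^ 3 / 3) + x * t)) (moment 0 x)).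
  apply (is_Cint_ext (fun t : R => kernel 0 x t)); [|apply is_Cint_moment].
  intros t. unfold kernel. simpl. ring.
Qed.

(** * The product of the first two moments at the origin *)

Local Close Scope C_scope.

Definition incomplete_moment (k : nat) (x : R) : R :=
  RInt (fun t : R => t ^ k * exp (- (t ^ 3 / 3))) 0 x.

Lemma ex_derive_incomplete_integrand (k : nat) (x : R) :
  ex_derive (fun t : R => t ^ k * exp (- (t ^ 3 / 3))) x.
Proof. auto_derive. trivial. Qed.

Lemma is_RInt_incomplete_moment (k : nat) (x : R) :
  is_RInt (fun t : R => t ^ k * exp (- (t ^ 3 / 3))) 0 x (incomplete_moment k x).
Proof.
  apply (RInt_correct (V := R_CompleteNormedModule)).
  apply (ex_RInt_continuous (V := R_CompleteNormedModule)). intros t _.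
  apply (ex_derive_continuous (V := R_NormedModule)), ex_derive_incomplete_integrand.
Qed.

Lemma is_derive_incomplete_moment (k : nat) (x : R) :
  is_derive (incomplete_moment k) x (x ^ k * exp (- (x ^ 3 / 3))).
Proof.
  apply (is_derive_RInt (V := R_CompleteNormedModule)
    (fun t : R => t ^ k * exp (- (t ^ 3 / 3))) (incomplete_moment k) 0 x).
  - exists (mkposreal 1 Rlt_0_1). intros y _. apply is_RInt_incomplete_moment.
  - apply (ex_derive_continuous (V := R_NormedModule)), ex_derive_incomplete_integrand.
Qed.

Lemma incomplete_moment_rescale (k : nat) (x : R) :
  is_RInt (fun v : R => x * ((x * v) ^ k * exp (- ((x * v) ^ 3 / 3)))) 0 1 (incomplete_moment k x).
Proof.
  pose proof (is_RInt_comp_lin (V := R_NormedModule)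
    (fun t : R => t ^ k * exp (- (t ^ 3 / 3))) x 0 0 1 (incomplete_moment k x)) as H.
  rewrite Rmult_0_r, Rmult_1_r, !Rplus_0_r in H.
  specialize (H (is_RInt_incomplete_moment k x)).
  eapply is_RInt_ext; [|exact H].
  intros v _. unfold scal; simpl. unfold mult; simpl. now rewrite Rplus_0_r.
Qed.

(** An antiderivative in [x] of [- x^2 (1 + v) exp (- x^3 (1 + v^3) / 3)], because
    [1 + v^3 = (1 + v) (1 - v + v^2)]. *)
Definition product_integrand (x v : R) : R :=
  exp (- (x ^ 3 * (1 + v ^ 3) / 3)) / (1 - v + v ^ 2).

Lemma quad_pos (v : R) : 3 / 4 <= 1 - v + v ^ 2.
Proof. pose proof (pow2_ge_0 (v - 1 / 2)). nra. Qed.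

Lemma is_derive_product_integrand (x v : R) :
  is_derive (fun x => product_integrand x v) x
   (- (x ^ 2 * (1 + v) * exp (- (x ^ 3 * (1 + v ^ 3) / 3)))).
Proof.
  unfold product_integrand.
  pose proof (quad_pos v).
  auto_derive; [lra|]. simpl pow in *. unfold Rdiv. field. lra.
Qed.

Lemma ex_RInt_product_integrand (x : R) : ex_RInt (product_integrand x) 0 1.
Proof.
  apply (ex_RInt_continuous (V := R_CompleteNormedModule)). intros v _.
  apply (ex_derive_continuous (V := R_NormedModule)).
  unfold product_integrand. pose proof (quad_pos v). auto_derive. lra.
Qed.

Definition product_tail (x : R) : R := RInt (product_integrand x) 0 1.

(** Minus the derivative of the product of the two incomplete moments: in that
    derivative each remaining incomplete moment is rescaled to the unit
    interval, which makes it the [v]-integral of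
    [x^2 (1 + v) exp (- x^3 (1 + v^3) / 3)]. *)
Lemma is_derive_product_tail (x : R) :
  is_derive product_tail x
    (- (x ^ 0 * exp (- (x ^ 3 / 3)) * incomplete_moment 1 x
        + incomplete_moment 0 x * (x ^ 1 * exp (- (x ^ 3 / 3))))).
Proof.
  assert (HD : forall y v : R, Derive (fun z => product_integrand z v) y =
     - (y ^ 2 * (1 + v) * exp (- (y ^ 3 * (1 + v ^ 3) / 3)))).
  { intros y v. apply is_derive_unique, is_derive_product_integrand. }
  assert (H : is_derive product_tail x
     (RInt (fun v => Derive (fun z => product_integrand z v) x) 0 1)).
  { apply is_derive_RInt_param.
    - exists (mkposreal 1 Rlt_0_1). intros y _ v _.
      eexists. apply is_derive_product_integrand.
    - intros v _.
      apply (continuity_2d_pt_ext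
        (fun y v : R => - (y ^ 2 * (1 + v) * exp (- (y ^ 3 * (1 + v ^ 3) / 3))))).
      { intros y w. symmetry. apply HD. }
      assert (Hp : forall n x y, continuity_2d_pt (fun u _ : R => u ^ n) x y).
      { intros n x0 y0. apply (continuity_1d_2d_pt_comp (fun u => u ^ n) (fun u _ => u)).
        - apply derivable_continuous_pt, derivable_pt_pow.
        - apply continuity_2d_pt_id1. }
      assert (Hq : forall n x y, continuity_2d_pt (fun _ u : R => u ^ n) x y).
      { intros n x0 y0. apply (continuity_1d_2d_pt_comp (fun u => u ^ n) (fun _ u => u)).
        - apply derivable_continuous_pt, derivable_pt_pow.
        - apply continuity_2d_pt_id2. }
      apply continuity_2d_pt_opp, continuity_2d_pt_mult;
        [apply continuity_2d_pt_mult; [apply Hp|]|].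
      + apply continuity_2d_pt_plus; [apply continuity_2d_pt_const|apply continuity_2d_pt_id2].
      + apply (continuity_1d_2d_pt_comp exp).
        * apply derivable_continuous_pt, derivable_pt_exp.
        * apply continuity_2d_pt_opp. unfold Rdiv.
          apply continuity_2d_pt_mult; [|apply continuity_2d_pt_const].
          apply continuity_2d_pt_mult; [apply Hp|].
          apply continuity_2d_pt_plus; [apply continuity_2d_pt_const|apply Hq].
    - exists (mkposreal 1 Rlt_0_1). intros y _. apply ex_RInt_product_integrand. }
  replace (- (x ^ 0 * exp (- (x ^ 3 / 3)) * incomplete_moment 1 x
              + incomplete_moment 0 x * (x ^ 1 * exp (- (x ^ 3 / 3)))))
    with (RInt (fun v => Derive (fun z => product_integrand z v) x) 0 1);
    [exact H|].
  apply is_RInt_unique.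
  apply (is_RInt_ext (fun v => - (exp (- (x ^ 3 / 3)) *
    (x * ((x * v) ^ 1 * exp (- ((x * v) ^ 3 / 3)))) +
     x * exp (- (x ^ 3 / 3)) *
    (x * ((x * v) ^ 0 * exp (- ((x * v) ^ 3 / 3))))))).
  { intros v _. rewrite HD.
    replace (- (x ^ 3 * (1 + v ^ 3) / 3)) with (- (x ^ 3 / 3) + - ((x * v) ^ 3 / 3))
      by field.
    rewrite exp_plus. lazymatch goal with |- ?a = ?b => change (@eq R a b) end.
    ring. }
  replace (- (x ^ 0 * exp (- (x ^ 3 / 3)) * incomplete_moment 1 x
              + incomplete_moment 0 x * (x ^ 1 * exp (- (x ^ 3 / 3))))) with
    (- (exp (- (x ^ 3 / 3)) * incomplete_moment 1 x + x * exp (- (x ^ 3 / 3)) * incomplete_moment 0 x)) by ring.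
  apply (is_RInt_opp (V := R_NormedModule)).
  apply (is_RInt_plus (V := R_NormedModule));
    apply (is_RInt_scal (V := R_NormedModule)); apply incomplete_moment_rescale.
Qed.

(** The integral of [1 / (1 - v + v^2)] over [[0, 1]], an arctangent. *)
Lemma product_tail_0 : product_tail 0 = 2 * PI / (3 * sqrt 3).
Proof.
  unfold product_tail. apply is_RInt_unique.
  assert (Hs : 0 < sqrt 3) by (apply sqrt_lt_R0; lra).
  assert (Hs2 : sqrt 3 * sqrt 3 = 3) by (apply sqrt_sqrt; lra).
  (* complete the square: [1 - v + v^2 = 3/4 (1 + ((2 v - 1) / sqrt 3)^2)] *)
  set (P := fun v : R => 2 / sqrt 3 * atan ((2 * v - 1) / sqrt 3)).
  replace (2 * PI / (3 * sqrt 3)) with (minus (P 1) (P 0)).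
  - apply (is_RInt_derive (V := R_CompleteNormedModule)).
    + intros v _. unfold P, product_integrand.
      pose proof (quad_pos v).
      auto_derive; [trivial|].
      replace (- (0 ^ 3 * (1 + v ^ 3) / 3)) with 0 by field.
      rewrite exp_0.
      assert (E : 1 + ((2 * v + - (1)) * / sqrt 3) ^ 2 = 4 / 3 * (1 - v + v ^ 2)).
      { replace (1 + ((2 * v + - (1)) * / sqrt 3) ^ 2) with
          (1 + (2 * v - 1) ^ 2 / (sqrt 3 * sqrt 3)) by (field; lra).
        rewrite Hs2. field. }
      simpl pow in E |- *. rewrite ?Rmult_1_r in *.
      rewrite E.
      apply (Rmult_eq_reg_l (sqrt 3 * sqrt 3)); [|nra].
      rewrite Hs2 at 2. field. lra.
    + intros v _. apply (ex_derive_continuous (V := R_NormedModule)).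
      unfold product_integrand. pose proof (quad_pos v). auto_derive. lra.
  - unfold minus, plus, opp; simpl. unfold P.
    replace ((2 * 1 - 1) / sqrt 3) with (tan (PI / 6)).
    2:{ rewrite tan_PI6. field. lra. }
    replace ((2 * 0 - 1) / sqrt 3) with (- tan (PI / 6)).
    2:{ rewrite tan_PI6. field. lra. }
    rewrite <- tan_neg. pose proof PI_RGT_0.
    rewrite !atan_tan by lra. field. lra.
Qed.

(** Analogue of the polar-coordinate computation of the Gaussian integral in
    one-variable form: both sides have the same derivative and agree at 0. *)
Lemma incomplete_moment_product (x : R) :
  incomplete_moment 0 x * incomplete_moment 1 x = 2 * PI / (3 * sqrt 3) - product_tail x.
Proof.
  assert (HD : forall y : R, is_derive
     (fun y => incomplete_moment 0 y * incomplete_moment 1 y + product_tail y) y 0).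
  { intros y.
    pose proof (is_derive_plus (V := R_NormedModule) _ _ _ _ _
      (Derive.is_derive_mult _ _ _ _ _ (is_derive_incomplete_moment 0 y) (is_derive_incomplete_moment 1 y))
      (is_derive_product_tail y)) as H.
    unfold plus in H; simpl in H.
    replace (_ + _) with 0 in H; [exact H|simpl; ring]. }
  assert (H0 : forall b : R, incomplete_moment 0 b * incomplete_moment 1 b + product_tail b =
    incomplete_moment 0 0 * incomplete_moment 1 0 + product_tail 0).
  { intros b.
    destruct (Rtotal_order 0 b) as [H|[H|H]].
    - symmetry. apply (eq_is_derive (V := R_NormedModule)
       (fun y => incomplete_moment 0 y * incomplete_moment 1 y + product_tail y)); [|exact H].
      intros t _. apply HD.
    - now subst.
    - apply (eq_is_derive (V := R_NormedModule)
       (fun y => incomplete_moment 0 y * incomplete_moment 1 y + product_tail y)); [|exact H].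
      intros t _. apply HD. }
  specialize (H0 x).
  assert (Hz : incomplete_moment 0 0 = 0) by (apply (RInt_point (V := R_CompleteNormedModule))).
  rewrite Hz, product_tail_0 in H0. lra.
Qed.

Lemma product_tail_bound (x : R) : 0 <= x ->
  Rabs (product_tail x) <= 4 / 3 * exp (- (x ^ 3 / 3)).
Proof.
  intros Hx.
  replace (4 / 3 * exp (- (x ^ 3 / 3))) with ((1 - 0) * (4 / 3 * exp (- (x ^ 3 / 3)))) by ring.
  refine (norm_RInt_le_const (V := R_NormedModule) (product_integrand x) 0 1 _ _ _ _ _).
  - lra.
  - intros v Hv. change (Rabs (product_integrand x v) <= 4 / 3 * exp (- (x ^ 3 / 3))).
    unfold product_integrand. pose proof (quad_pos v).
    rewrite Rabs_pos_eq.
    2:{ apply Rlt_le, Rdiv_lt_0_compat; [apply exp_pos|lra]. }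
    unfold Rdiv at 1. rewrite Rmult_comm.
    apply Rmult_le_compat.
    + apply Rlt_le, Rinv_0_lt_compat. lra.
    + apply Rlt_le, exp_pos.
    + replace (4 / 3) with (/ (3 / 4)) by field. apply Rinv_le_contravar; lra.
    + apply exp_le.
      assert (0 <= x ^ 3 * v ^ 3) by (apply Rmult_le_pos; apply pow_le; lra). lra.
  - apply (RInt_correct (V := R_CompleteNormedModule)), ex_RInt_product_integrand.
Qed.

Lemma is_Cint_limit (f F : R -> C) (l : C) :
  is_Cint f l ->
  (forall b : R, is_RInt (V := C_R_NormedModule) f 0 b (F b)) ->
  forall eps : R, 0 < eps -> exists T : R, forall b : R, T < b ->
     Cmod (F b - l)%C < eps.
Proof.
  intros HI HF eps He.
  assert (He2 : 0 < eps / sqrt 2) by (apply Rdiv_lt_0_compat; [lra|apply Rlt_sqrt2_0]).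
  destruct (HI _ (locally_ball (l : C_UniformSpace) (mkposreal _ He2)))
    as [Q S HQ [T HT] HQS].
  exists T. intros b Hb.
  destruct (HQS 0 b HQ (HT b Hb)) as [y [Hy HP]]. simpl in Hy.
  assert (E : F b = y).
  { rewrite <- (is_RInt_unique (V := C_R_CompleteNormedModule) _ _ _ _ Hy).
    symmetry. apply (is_RInt_unique (V := C_R_CompleteNormedModule)), HF. }
  rewrite E.
  apply (C_NormedModule_mixin_compat2 (l : C) y) in HP. simpl in HP.
  replace (sqrt 2 * (eps / sqrt 2))%R with eps in HP; [exact HP|].
  field. pose proof Rlt_sqrt2_0. lra.
Qed.

Lemma incomplete_moment_limit (k : nat) (eps : R) : 0 < eps ->
  exists T : R, forall b : R, T < b -> Cmod (incomplete_moment k b - moment k 0)%C < eps.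
Proof.
  apply (is_Cint_limit (fun t : R => kernel k 0 t) (fun b => RtoC (incomplete_moment k b))).
  - apply is_Cint_moment.
  - intros b.
    apply (is_RInt_ext (V := C_R_NormedModule)
      (fun t : R => ((t ^ k * exp (- (t ^ 3 / 3)), 0) : C))).
    { intros t _. unfold kernel. rewrite <- !RtoC_pow.
      replace (- (RtoC (t ^ 3) / 3) + 0 * t)%C with (RtoC (- (t ^ 3 / 3))).
      2:{ rewrite RtoC_opp, RtoC_div by lra. ring. }
      unfold Cexp, Re, Im, RtoC, Cmult; simpl fst; simpl snd.
      rewrite cos_0, sin_0. simpl pow. f_equal; ring. }
    apply (is_RInt_fct_extend_pair (U := R_NormedModule) (V := R_NormedModule)).
    + apply is_RInt_incomplete_moment.
    + pose proof (is_RInt_const (V := R_NormedModule) 0 b 0) as H.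
      change (scal (b - 0) 0) with ((b - 0) * 0) in H. rewrite Rmult_0_r in H. exact H.
Qed.

(** The limit of [incomplete_moment_product] at infinity.  In terms of the Gamma
    function this is the reflection formula at [1/3]. *)
Lemma moment_product : (moment 0 0 * moment 1 0)%C = RtoC (2 * PI / (3 * sqrt 3)).
Proof.
  set (P := 2 * PI / (3 * sqrt 3)).
  apply Ceq_minus, Cmod_eq_0.
  apply Rle_antisym; [|apply Cmod_ge_0].
  apply Rnot_lt_le. intros Hpos.
  set (D := Cmod (moment 0 0 * moment 1 0 - P)%C) in *.
  set (m0 := moment 0 0) in *. set (m1 := moment 1 0) in *.
  set (K := Cmod m0 + Cmod m1 + 1).
  assert (HK : 1 <= K).
  { unfold K. pose proof (Cmod_ge_0 m0). pose proof (Cmod_ge_0 m1). lra. }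
  set (eps := Rmin 1 (D / (4 * K))).
  assert (He : 0 < eps).
  { unfold eps. apply Rmin_glb_lt; [lra|]. apply Rdiv_lt_0_compat; lra. }
  assert (HeK : eps * K <= D / 4).
  { pose proof (Rmin_r 1 (D / (4 * K))) as H. fold eps in H.
    apply Rle_trans with (D / (4 * K) * K).
    - apply Rmult_le_compat_r; lra.
    - right. field. lra. }
  pose proof (Rmin_l 1 (D / (4 * K))) as He1. fold eps in He1.
  destruct (incomplete_moment_limit 0 eps He) as [T0 HT0].
  destruct (incomplete_moment_limit 1 eps He) as [T1 HT1].
  destruct (exp_neg_small (4 / 3) (D / 4)) as [T2 [_ HT2]]; [lra|lra|].
  set (b := Rmax (Rmax T0 T1) (Rmax (3 * T2) 1) + 1).
  assert (Hb : T0 < b /\ T1 < b /\ 3 * T2 < b /\ 1 < b).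
  { unfold b. pose proof (Rmax_l (Rmax T0 T1) (Rmax (3 * T2) 1)).
    pose proof (Rmax_r (Rmax T0 T1) (Rmax (3 * T2) 1)).
    pose proof (Rmax_l T0 T1). pose proof (Rmax_r T0 T1).
    pose proof (Rmax_l (3 * T2) 1). pose proof (Rmax_r (3 * T2) 1). lra. }
  destruct Hb as [Hb0 [Hb1 [Hb2 Hb3]]].
  specialize (HT0 b Hb0). specialize (HT1 b Hb1). fold m0 in HT0. fold m1 in HT1.
  specialize (HT2 (b / 3) ltac:(lra)).
  assert (HJ : Cmod (incomplete_moment 0 b * incomplete_moment 1 b - P)%C < D / 4).
  { rewrite <- RtoC_mult, <- RtoC_minus, Cmod_R, incomplete_moment_product. fold P.
    replace (P - product_tail b - P) with (- product_tail b) by ring.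
    rewrite Rabs_Ropp.
    eapply Rle_lt_trans; [apply product_tail_bound; lra|].
    eapply Rle_lt_trans; [|exact HT2].
    apply Rmult_le_compat_l; [lra|]. apply exp_le. nra. }
  set (a0 := RtoC (incomplete_moment 0 b)) in *. set (a1 := RtoC (incomplete_moment 1 b)) in *.
  assert (HD : D <= D / 4 + (eps * Cmod m1 + (Cmod m0 + eps) * eps)).
  { unfold D at 1.
    replace (m0 * m1 - P)%C with ((a0 * a1 - P) + (- ((a0 - m0) * m1) + - (a0 * (a1 - m1))))%C
      by ring.
    eapply Rle_trans; [apply Cmod_triangle|].
    apply Rplus_le_compat; [now apply Rlt_le|].
    eapply Rle_trans; [apply Cmod_triangle|].
    rewrite !Cmod_opp, !Cmod_mult.
    apply Rplus_le_compat.
    - apply Rmult_le_compat_r; [apply Cmod_ge_0|now apply Rlt_le].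
    - apply Rmult_le_compat; try apply Cmod_ge_0.
      + replace a0 with (m0 + (a0 - m0))%C by ring.
        eapply Rle_trans; [apply Cmod_triangle|]. lra.
      + now apply Rlt_le. }
  unfold K in *. nra.
Qed.

Local Open Scope C_scope.

(** * The Airy function *)

Definition omega : C := cis (2 * PI / 3).

Lemma cis_plus (a b : R) : cis (a + b) = cis a * cis b.
Proof.
  unfold cis. rewrite <- Cexp_plus. f_equal. rewrite RtoC_plus. ring.
Qed.

Lemma cis_alt (t : R) : cis t = (cos t, sin t).
Proof.
  unfold cis, Cexp. unfold Ci, RtoC, Cmult, Re, Im; simpl.
  replace (0 * t - 1 * 0)%R with 0%R by ring.
  replace (0 * 0 + 1 * t)%R with t by ring.
  rewrite exp_0. f_equal; ring.
Qed.

Lemma cis_0 : cis 0 = 1.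
Proof. rewrite cis_alt, cos_0, sin_0. reflexivity. Qed.

Lemma cis_PI : cis PI = - (1).
Proof.
  rewrite cis_alt, cos_PI, sin_PI. unfold Copp, RtoC; simpl. f_equal. ring.
Qed.

Lemma cis_opp_l (t : R) : cis (- t) * cis t = 1.
Proof. rewrite <- cis_plus, Rplus_opp_l. apply cis_0. Qed.

Lemma omega_cube : omega * (omega * omega) = 1.
Proof.
  unfold omega. rewrite <- !cis_plus.
  replace (2 * PI / 3 + (2 * PI / 3 + 2 * PI / 3))%R with (PI + PI)%R by field.
  rewrite cis_plus, cis_PI. ring.
Qed.

Lemma cis_opp_2PI3 : cis (- (2 * PI / 3)) = omega * omega.
Proof.
  transitivity (cis (- (2 * PI / 3)) * (omega * (omega * omega))).
  - rewrite omega_cube. ring.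
  - transitivity (cis (- (2 * PI / 3)) * omega * (omega * omega)); [ring|].
    unfold omega at 1. rewrite cis_opp_l. ring.
Qed.

Lemma omega_alt : omega = ((- / 2)%R, (sqrt 3 / 2)%R).
Proof.
  unfold omega. rewrite cis_alt.
  replace (2 * PI / 3)%R with (2 * (PI / 3))%R by field.
  rewrite cos_2PI3, sin_2PI3. f_equal; field.
Qed.

Lemma omega_sum : 1 + omega + omega * omega = 0.
Proof.
  rewrite omega_alt. unfold RtoC, Cplus, Cmult; simpl.
  assert (Hs2 : (sqrt 3 * sqrt 3 = 3)%R) by (apply sqrt_sqrt; lra).
  f_equal; [|field].
  apply (Rmult_eq_reg_l 4); [|lra].
  replace (4 * (1 + - / 2 + (- / 2 * - / 2 - sqrt 3 / 2 * (sqrt 3 / 2))))%R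
   with (3 - sqrt 3 * sqrt 3)%R by field.
  rewrite Hs2. ring.
Qed.

(** This number, a rotation of [sqrt 3], enters both the initial values of [Ai]
    and the Wronskian of [Ai_(-1)] and [Ai_1]. *)
Lemma omega_diff : omega - omega * omega = Ci * sqrt 3.
Proof.
  replace (omega * omega) with (- (1) - omega).
  - rewrite omega_alt. unfold Ci, RtoC, Cminus, Copp, Cplus, Cmult; simpl.
    f_equal; field.
  - transitivity (- (1) - omega + (1 + omega + omega * omega)); [|ring].
    rewrite omega_sum. ring.
Qed.

Lemma cis_PI3 : cis (PI / 3) = - (omega * omega).
Proof.
  rewrite <- cis_opp_2PI3.
  replace (PI / 3)%R with (PI + - (2 * PI / 3))%R by field.
  rewrite cis_plus, cis_PI. ring.
Qed.

Lemma cis_opp_PI3 : cis (- (PI / 3)) = - omega.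
Proof.
  unfold omega.
  replace (2 * PI / 3)%R with (PI + - (PI / 3))%R by field.
  rewrite cis_plus, cis_PI. ring.
Qed.

Lemma RtoC_PI_neq_0 : RtoC PI <> 0.
Proof. intros H. apply RtoC_inj in H. pose proof PI_RGT_0. lra. Qed.

(** The [k]-th derivative of [Ai]. *)
Definition Ai_deriv (k : nat) (x : C) : C :=
  (omega ^ S k * moment k (omega * x)
   - (omega * omega) ^ S k * moment k (omega * omega * x)) / (2 * PI * Ci).

(** On the rays of direction [exp (PI i / 3)] and [exp (- PI i / 3)] one has
    [t^3 = - |t|^3], so that each of the two integrals is a moment at a rotated
    argument. *)
Lemma Ai_eq_Ai_deriv_0 (x : C) : Ai x = Ai_deriv 0 x.
Proof.
  assert (H : forall c : C, c * (c * c) = - (1) -> forall theta : R, cis theta = c ->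
    Cint_from_infty theta (fun t : C => Cexp (t ^ 3 / 3 - x * t)) 0
    = - c * moment 0 (- c * x)).
  { intros c Hc theta Hth. unfold Cint_from_infty. rewrite Hth.
    rewrite (is_Cint_unique (fun s : R => Cexp ((0 + s * c) ^ 3 / 3 - x * (0 + s * c)))
      (moment 0 (- c * x))).
    - ring.
    - apply (is_Cint_ext (fun t : R => kernel 0 (- c * x) t)); [|apply is_Cint_moment].
      intros t. unfold kernel. simpl Cpow. rewrite Cmult_1_l. f_equal.
      transitivity (c * (c * c) * (t * (t * (t * 1)) / 3) + - c * x * t).
      + rewrite Hc. unfold Cdiv. simpl. ring.
      + simpl. unfold Cdiv. ring. }
  unfold Ai, Ai_deriv. cbv zeta.
  rewrite (H (- omega)) with (2 := cis_opp_PI3).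
  rewrite (H (- (omega * omega))) with (2 := cis_PI3).
  - simpl. unfold Cdiv.
    replace (- - omega) with omega by ring.
    replace (- - (omega * omega)) with (omega * omega) by ring. ring.
  - transitivity (- ((omega * (omega * omega)) * (omega * (omega * omega)))); [ring|].
    rewrite omega_cube. ring.
  - transitivity (- (omega * (omega * omega))); [ring|].
    rewrite omega_cube. ring.
Qed.

Lemma Cderiv_lin (f : C -> C) (c z l : C) :
  Cderiv f (c * z) l -> Cderiv (fun x => f (c * x)) z (c * l).
Proof.
  intros H. apply (Cderiv_eq _ _ (l * (c * 1))); [|ring].
  apply (Cderiv_comp f (fun x => c * x)); [exact H|].
  apply Cderiv_scal, Cderiv_id.
Qed.

Lemma Cderiv_Ai_deriv (k : nat) (x : C) : Cderiv (Ai_deriv k) x (Ai_deriv (S k) x).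
Proof.
  unfold Ai_deriv.
  apply (Cderiv_ext (fun x => / (2 * PI * Ci) * (omega ^ S k * moment k (omega * x)
   - (omega * omega) ^ S k * moment k (omega * omega * x)))).
  { intros y. unfold Cdiv. ring. }
  eapply Cderiv_eq.
  - apply Cderiv_scal, Cderiv_minus; apply Cderiv_scal.
    + apply Cderiv_lin, Cderiv_moment.
    + apply Cderiv_lin, Cderiv_moment.
  - rewrite !(Cpow_S _ (S k)). unfold Cdiv. ring.
Qed.

(** The inhomogeneous terms of the two rotated moments are both 1, and they
    cancel. *)
Lemma Ai_deriv_rec (k : nat) (x : C) :
  Ai_deriv (S (S k)) x = x * Ai_deriv k x + INR k * Ai_deriv (k - 1) x.
Proof.
  assert (E1 : forall n, omega ^ S (S (S n)) = omega ^ n).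
  { intros n. rewrite !Cpow_S.
    transitivity (omega * (omega * omega) * omega ^ n); [ring|].
    rewrite omega_cube. ring. }
  assert (E2 : forall n, (omega * omega) ^ S (S (S n)) = (omega * omega) ^ n).
  { intros n. rewrite !Cpow_S.
    transitivity (omega * (omega * omega) * (omega * (omega * omega)) * (omega * omega) ^ n);
      [ring|].
    rewrite omega_cube. ring. }
  unfold Ai_deriv.
  rewrite E1, E2, !moment_rec.
  destruct k as [|k].
  - simpl. field. split; [apply Ci_nz|apply RtoC_PI_neq_0].
  - replace (S k - 1)%nat with k by lia. unfold Cdiv.
    rewrite (Cpow_S 0). rewrite (Cpow_S omega (S k)), (Cpow_S (omega * omega) (S k)). ring.
Qed.

(** Along such a ray the argument of the moment ends up in the left half-plane,
    where moments are bounded. *)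
Lemma moment_ray_bound (k : nat) (c y : C) : (Re c < 0)%R ->
  exists B T : R, forall s : R, (T <= s)%R -> (Cmod (moment k (c * (y + s))) <= B)%R.
Proof.
  intros Hc. destruct (moment_bound k 0) as [B HB].
  exists B, (Re (c * y) / (- Re c))%R. intros s Hs. apply HB.
  replace (c * (y + s)) with (c * y + c * s) by ring.
  rewrite re_plus, re_scal_r.
  apply (Rmult_le_compat_r (- Re c)) in Hs; [|lra].
  unfold Rdiv in Hs. rewrite Rmult_assoc, Rinv_l, Rmult_1_r in Hs by lra. lra.
Qed.

Lemma Re_omega : Re omega = (- / 2)%R.
Proof. now rewrite omega_alt. Qed.

Lemma Re_omega2 : Re (omega * omega) = (- / 2)%R.
Proof.
  replace (omega * omega) with (- (1) - omega).
  - unfold Cminus. rewrite re_plus, !re_opp, re_RtoC, Re_omega. field.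
  - transitivity (- (1) - omega + (1 + omega + omega * omega)); [|ring].
    rewrite omega_sum. ring.
Qed.

Lemma Cmod_minus_le (a b : C) : (Cmod (a - b) <= Cmod a + Cmod b)%R.
Proof.
  unfold Cminus. rewrite <- (Cmod_opp b). apply Cmod_triangle.
Qed.

Lemma Ai_deriv_bounded (k : nat) (y : C) :
  exists B T : R, forall s : R, (T <= s)%R -> (Cmod (Ai_deriv k (y + s)) <= B)%R.
Proof.
  destruct (moment_ray_bound k omega y) as [B1 [T1 H1]].
  { rewrite Re_omega. lra. }
  destruct (moment_ray_bound k (omega * omega) y) as [B2 [T2 H2]].
  { rewrite Re_omega2. lra. }
  exists ((Cmod (omega ^ S k) * B1 + Cmod ((omega * omega) ^ S k) * B2)
          * Cmod (/ (2 * PI * Ci)))%R, (Rmax T1 T2).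
  intros s Hs.
  pose proof (Rmax_l T1 T2). pose proof (Rmax_r T1 T2).
  unfold Ai_deriv, Cdiv. rewrite Cmod_mult.
  apply Rmult_le_compat_r; [apply Cmod_ge_0|].
  eapply Rle_trans; [apply Cmod_minus_le|]. rewrite !Cmod_mult.
  apply Rplus_le_compat; (apply Rmult_le_compat_l; [|]).
  - apply Cmod_ge_0.
  - apply H1. lra.
  - apply Cmod_ge_0.
  - apply H2. lra.
Qed.

(** Induction on [n] for all [k] at once: in
    [x Ai^(k) = Ai^(k+2) - k Ai^(k-1)] the right-hand side is [O (s^(-n))] by
    induction, and [|x| >= s / 2] for large [s]. *)
Lemma Ai_deriv_decay (n k : nat) (y : C) :
  exists B T : R, (0 < T)%R /\ forall s : R, (T <= s)%R ->
    (Cmod (Ai_deriv k (y + s)) * s ^ n <= B)%R.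
Proof.
  revert k. induction n as [|n IH]; intros k.
  - destruct (Ai_deriv_bounded k y) as [B [T H]].
    exists B, (Rmax T 1)%R. split.
    + pose proof (Rmax_r T 1). lra.
    + intros s Hs. pose proof (Rmax_l T 1). simpl. rewrite Rmult_1_r. apply H. lra.
  - destruct (IH (S (S k))) as [B1 [T1 [HT1 H1]]].
    destruct (IH (k - 1)%nat) as [B2 [T2 [HT2 H2]]].
    exists (2 * (B1 + INR k * B2))%R, (Rmax (Rmax T1 T2) (2 * Cmod y))%R.
    pose proof (Rmax_l (Rmax T1 T2) (2 * Cmod y)).
    pose proof (Rmax_r (Rmax T1 T2) (2 * Cmod y)).
    pose proof (Rmax_l T1 T2). pose proof (Rmax_r T1 T2).
    split; [lra|]. intros s Hs.
    specialize (H1 s ltac:(lra)). specialize (H2 s ltac:(lra)).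
    set (x := y + s) in *.
    assert (Hx : (s / 2 <= Cmod x)%R).
    { pose proof (Cmod_minus_le x y) as Ht.
      replace (x - y) with (RtoC s) in Ht by (unfold x; ring).
      rewrite Cmod_R, Rabs_pos_eq in Ht; lra. }
    assert (Hp : (0 <= s ^ n)%R) by (apply pow_le; lra).
    assert (Hr : (Cmod x * Cmod (Ai_deriv k x) <=
       Cmod (Ai_deriv (S (S k)) x) + INR k * Cmod (Ai_deriv (k - 1) x))%R).
    { rewrite <- Cmod_mult.
      replace (x * Ai_deriv k x) with (Ai_deriv (S (S k)) x - INR k * Ai_deriv (k - 1) x)
        by (rewrite Ai_deriv_rec; ring).
      eapply Rle_trans; [apply Cmod_minus_le|].
      rewrite Cmod_mult, Cmod_R, Rabs_pos_eq by apply pos_INR. lra. }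
    pose proof (Cmod_ge_0 (Ai_deriv k x)) as Ha. pose proof (pos_INR k) as Hk.
    apply Rle_trans with (2 * (Cmod x * Cmod (Ai_deriv k x) * s ^ n))%R.
    + simpl. replace (Cmod (Ai_deriv k x) * (s * s ^ n))%R
        with (2 * (s / 2 * (Cmod (Ai_deriv k x) * s ^ n)))%R by field.
      apply Rmult_le_compat_l; [lra|]. rewrite Rmult_assoc.
      apply Rmult_le_compat_r; [|exact Hx]. now apply Rmult_le_pos.
    + apply Rmult_le_compat_l; [lra|].
      apply Rle_trans with
        ((Cmod (Ai_deriv (S (S k)) x) + INR k * Cmod (Ai_deriv (k - 1) x)) * s ^ n)%R.
      * apply Rmult_le_compat_r; assumption.
      * rewrite Rmult_plus_distr_r, Rmult_assoc.
        apply Rplus_le_compat; [exact H1|].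
        apply Rmult_le_compat_l; assumption.
Qed.

Lemma Cderiv_0_const (f : C -> C) (z : C) :
  (forall x : C, Cderiv f x 0) -> f z = f 0.
Proof.
  intros H. apply Ceq_minus, Cmod_eq_0, Rle_antisym; [|apply Cmod_ge_0].
  pose proof (mean_value_bound (fun s : R => f (0 + s * z)) (fun _ => z * 0) 0) as Hm.
  simpl in Hm. replace (0 + 1 * z) with z in Hm by ring.
  replace (0 + 0 * z) with (RtoC 0) in Hm by ring.
  apply Hm.
  - intros t. apply Rderiv_path, H.
  - intros t. apply (continuous_const (U := R_UniformSpace) (V := C_UniformSpace)).
  - intros t _. rewrite Cmult_0_r, Cmod_0. lra.
Qed.

(** The Wronskians depend on the initial values only through this product; the
    factors themselves involve [Gamma (1/3)] and [Gamma (2/3)]. *)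
Lemma Ai_0_mult_Ai_deriv_0 : Ai_deriv 0 0 * Ai_deriv 1 0 = - / (2 * PI * sqrt 3).
Proof.
  assert (Hs : (0 < sqrt 3)%R) by (apply sqrt_lt_R0; lra).
  assert (Hs2 : (sqrt 3 * sqrt 3 = 3)%R) by (apply sqrt_sqrt; lra).
  assert (HPI := PI_RGT_0).
  assert (HsC : RtoC (sqrt 3) <> 0) by (intros H; apply RtoC_inj in H; lra).
  assert (E0 : Ai_deriv 0 0 = Ci * sqrt 3 * moment 0 0 / (2 * PI * Ci)).
  { unfold Ai_deriv. rewrite !Cmult_0_r, <- omega_diff. simpl. unfold Cdiv. ring. }
  assert (E1 : Ai_deriv 1 0 = - (Ci * sqrt 3 * moment 1 0) / (2 * PI * Ci)).
  { unfold Ai_deriv. rewrite !Cmult_0_r, <- omega_diff. simpl. rewrite !Cmult_1_r.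
    replace (omega * omega * (omega * omega)) with omega.
    - unfold Cdiv. ring.
    - transitivity (omega * (omega * omega) * omega); [rewrite omega_cube|]; ring. }
  rewrite E0, E1.
  transitivity (- (sqrt 3 * sqrt 3 * (moment 0 0 * moment 1 0)) / (4 * (PI * PI))).
  { field. split; [apply RtoC_PI_neq_0|apply Ci_nz]. }
  rewrite moment_product, <- RtoC_mult, Hs2.
  rewrite RtoC_div, !RtoC_mult by nra.
  field. split; [exact HsC|apply RtoC_PI_neq_0].
Qed.

(** For a cube root of unity [a], the function [Ai (a x)] again solves Airy's
    equation.  So the Wronskian of two of them is constant, and it can be
    evaluated at 0. *)
Lemma Ai_wronskian (a b x : C) :
  a * (a * a) = 1 -> b * (b * b) = 1 ->
  Ai_deriv 0 (a * x) * (b * Ai_deriv 1 (b * x)) - a * Ai_deriv 1 (a * x) * Ai_deriv 0 (b * x)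
  = (a - b) / (2 * PI * sqrt 3).
Proof.
  intros Ha Hb.
  rewrite (Cderiv_0_const (fun x => Ai_deriv 0 (a * x) * (b * Ai_deriv 1 (b * x))
    - a * Ai_deriv 1 (a * x) * Ai_deriv 0 (b * x))).
  - rewrite !Cmult_0_r.
    transitivity (Ai_deriv 0 0 * Ai_deriv 1 0 * (b - a)); [ring|].
    rewrite Ai_0_mult_Ai_deriv_0. unfold Cdiv. ring.
  - clear x. intros x. eapply Cderiv_eq.
    + apply Cderiv_minus; apply Cderiv_mult.
      * apply Cderiv_lin, Cderiv_Ai_deriv.
      * apply Cderiv_scal, Cderiv_lin, Cderiv_Ai_deriv.
      * apply Cderiv_scal, Cderiv_lin, Cderiv_Ai_deriv.
      * apply Cderiv_lin, Cderiv_Ai_deriv.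
    + cbv beta. rewrite !Ai_deriv_rec. simpl INR.
      transitivity ((b * (b * b) - a * (a * a)) * (x * Ai_deriv 0 (a * x) * Ai_deriv 0 (b * x)));
        [ring|]. rewrite Ha, Hb. ring.
Qed.

(** * Variation of parameters *)

(** Growth allowed for a solution along a direction of integration. *)
Definition moderate (f : R -> C) : Prop :=
  exists (n : nat) (K T : R), (0 < T)%R /\ forall s : R, (T <= s)%R ->
    (Cmod (f s) <= K * s ^ n)%R.

(** Decay faster than every power, which absorbs any [moderate] factor. *)
Definition rapid (f : R -> C) : Prop :=
  forall n : nat, exists K T : R, (0 < T)%R /\ forall s : R, (T <= s)%R ->
    (Cmod (f s) * s ^ n <= K)%R.

Lemma moderate_rapid (f g : R -> C) :
  moderate f -> rapid g -> rapid (fun s => f s * g s).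
Proof.
  intros [m [K [T [HT Hf]]]] Hg n.
  destruct (Hg (m + n)%nat) as [B [T' [HT' Hg']]].
  (* [g] is used with exponent [m + n] to pay for the growth [s^m] of [f] *)
  exists (K * B)%R, (Rmax T T').
  pose proof (Rmax_l T T'). pose proof (Rmax_r T T').
  split; [lra|]. intros s Hs.
  specialize (Hf s ltac:(lra)). specialize (Hg' s ltac:(lra)).
  assert (Hm : (0 < s ^ m)%R) by (apply pow_lt; lra).
  assert (Hn : (0 < s ^ n)%R) by (apply pow_lt; lra).
  pose proof (Cmod_ge_0 (f s)). pose proof (Cmod_ge_0 (g s)).
  assert (HK : (0 <= K)%R) by nra.
  rewrite Cmod_mult. rewrite pow_add in Hg'.
  apply Rle_trans with (K * s ^ m * Cmod (g s) * s ^ n)%R.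
  - apply Rmult_le_compat_r; [lra|]. apply Rmult_le_compat_r; lra.
  - replace (K * s ^ m * Cmod (g s) * s ^ n)%R with
      (K * (Cmod (g s) * (s ^ m * s ^ n)))%R by ring.
    now apply Rmult_le_compat_l.
Qed.

Lemma rapid_minus (f g : R -> C) :
  rapid f -> rapid g -> rapid (fun s => f s - g s).
Proof.
  intros Hf Hg n.
  destruct (Hf n) as [B [T [HT H1]]]. destruct (Hg n) as [B' [T' [HT' H2]]].
  exists (B + B')%R, (Rmax T T').
  pose proof (Rmax_l T T'). pose proof (Rmax_r T T').
  split; [lra|]. intros s Hs.
  specialize (H1 s ltac:(lra)). specialize (H2 s ltac:(lra)).
  assert (Hn : (0 < s ^ n)%R) by (apply pow_lt; lra).
  eapply Rle_trans; [apply Rmult_le_compat_r; [lra|apply Cmod_minus_le]|].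
  rewrite Rmult_plus_distr_r. lra.
Qed.

Lemma rapid_scal (c : C) (f : R -> C) : rapid f -> rapid (fun s => c * f s).
Proof.
  intros Hf n. destruct (Hf n) as [B [T [HT H1]]].
  exists (Cmod c * B)%R, T. split; [exact HT|]. intros s Hs.
  rewrite Cmod_mult, Rmult_assoc. apply Rmult_le_compat_l; [apply Cmod_ge_0|].
  now apply H1.
Qed.

Lemma rapid_lim (f : R -> C) (eps : R) : rapid f -> (0 < eps)%R ->
  exists T : R, forall b : R, (T < b)%R -> (Cmod (f b - 0)%C < eps)%R.
Proof.
  intros Hf He. destruct (Hf 1%nat) as [B [T [HT H]]].
  exists (Rmax T (B / eps)). intros b Hb.
  pose proof (Rmax_l T (B / eps)). pose proof (Rmax_r T (B / eps)).
  specialize (H b ltac:(lra)). simpl in H. rewrite Rmult_1_r in H.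
  replace (f b - 0) with (f b) by ring.
  apply (Rmult_lt_reg_r b); [lra|].
  eapply Rle_lt_trans; [exact H|].
  apply Rle_lt_trans with (eps * (B / eps))%R; [right; field; lra|].
  apply Rmult_lt_compat_l; lra.
Qed.

Lemma Ai_deriv_rapid (k : nat) (y : C) (a : R) : (0 < a)%R ->
  rapid (fun s => Ai_deriv k (y + (a * s)%R)).
Proof.
  intros Ha n. destruct (Ai_deriv_decay n k y) as [B [T [HT H]]].
  exists (B / a ^ n)%R, (T / a)%R.
  assert (Hn : (0 < a ^ n)%R) by now apply pow_lt.
  split; [now apply Rdiv_lt_0_compat|].
  intros s Hs.
  assert (HTs : (T <= a * s)%R).
  { apply (Rmult_le_compat_l a) in Hs; [|lra].
    replace (a * (T / a))%R with T in Hs by (field; lra). exact Hs. }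
  specialize (H (a * s)%R HTs). rewrite Rpow_mult_distr in H.
  apply (Rmult_le_reg_r (a ^ n)); [exact Hn|].
  replace (B / a ^ n * a ^ n)%R with B by (field; lra). lra.
Qed.

Lemma Rpower_2_3_cube (u : R) : (0 < u)%R ->
  let a := Rpower u (2 / 3) in (a * (a * a) = u ^ 2)%R.
Proof.
  intros Hu a. unfold a. rewrite <- !Rpower_plus.
  rewrite <- Rpower_pow by exact Hu. f_equal. simpl. field.
Qed.

Section Representation.

Variables (u : R) (p dp F F' F'' : C -> C).
Hypothesis (Hu : (0 < u)%R).
Hypothesis (Hp : forall z, Cderiv p z (dp z)).
Hypothesis (HF : forall z, Cderiv F z (F' z)).
Hypothesis (HF' : forall z, Cderiv F' z (F'' z)).
Hypothesis (Hode : forall z, F'' z - u ^ 2 * z * F z = p z).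

Let a : R := Rpower u (2 / 3).

(** The integrand [p A] is the derivative of [F' A - F A'], which is rapidly
    decaying along the ray because [F] and [F'] are moderate there.  The
    convergence of the integral comes with its value. *)
Lemma ray_integral (j : Z) (z : C) :
  let d := cis (2 * PI * IZR j / 3) in
  let c := cis (- (2 * PI * IZR j / 3)) in
  c * (c * c) = 1 ->
  moderate (fun s : R => F (z + s * d)) ->
  moderate (fun s : R => F' (z + s * d)) ->
  Cint_from_infty (2 * PI * IZR j / 3) (fun t => p t * Ai_ j (a * t)) z
  = F' z * Ai_deriv 0 (c * (a * z)) - F z * (c * a * Ai_deriv 1 (c * (a * z))).
Proof.
  intros d c Hc Hm Hm'.
  assert (Ha : (0 < a)%R) by (unfold a, Rpower; apply exp_pos).
  assert (Hcd : c * d = 1) by apply cis_opp_l.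
  assert (Ha3 : RtoC a * (a * a) = u ^ 2).
  { rewrite <- !RtoC_mult, <- RtoC_pow. f_equal. now apply Rpower_2_3_cube. }
  set (A := fun (k : nat) (t : C) => Ai_deriv k (c * a * t)).
  assert (HA : forall k t, Cderiv (A k) t (c * a * A (S k) t)).
  { intros k t. apply Cderiv_lin, Cderiv_Ai_deriv. }
  set (H := fun t : C => F' t * A 0%nat t - F t * (c * a * A 1%nat t)).
  assert (HH : forall t, Cderiv H t (p t * A 0%nat t)).
  { intros t. eapply Cderiv_eq.
    - apply Cderiv_minus; apply Cderiv_mult.
      + apply HF'.
      + apply HA.
      + apply HF.
      + apply Cderiv_scal, HA.
    - cbv beta. rewrite <- Hode. unfold A at 4. rewrite Ai_deriv_rec. simpl INR.
      fold (A 0%nat t).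
      transitivity (F'' t * A 0%nat t -
         (c * (c * c)) * (RtoC a * (a * a)) * t * F t * A 0%nat t); [unfold A; ring|].
      rewrite Hc, Ha3. ring. }
  assert (HpA : Rcontinuous (fun s : R => p (z + s * d) * A 0%nat (z + s * d))).
  { apply (Rcontinuous_path (fun t => p t * A 0%nat t)
      (fun t => dp t * A 0%nat t + p t * (c * a * A 1%nat t))).
    intros t. apply Cderiv_mult; [apply Hp|apply HA]. }
  assert (HAr : forall k, rapid (fun s : R => A k (z + s * d))).
  { intros k n. destruct (Ai_deriv_rapid k (c * a * z) a Ha n) as [B [T [HT HB]]].
    exists B, T. split; [exact HT|]. intros s Hs. unfold A.
    replace (c * a * (z + s * d)) with (c * a * z + (a * s)%R).
    - now apply HB.
    - rewrite RtoC_mult. transitivity (c * a * z + (c * d) * (a * s)); [|ring].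
      rewrite Hcd. ring. }
  assert (HI : is_Cint (fun s : R => d * (p (z + s * d) * A 0%nat (z + s * d)))
     (0 - H (z + 0 * d))).
  { apply (is_Cint_FTC (fun s : R => H (z + s * d))).
    - intros t. apply Rderiv_path, HH.
    - now apply Rcontinuous_scal.
    - intros eps He. apply rapid_lim; [|exact He].
      unfold H. apply rapid_minus; apply moderate_rapid; trivial.
      now apply rapid_scal. }
  (* [c = 1 / d] removes the factor [d] contributed by the parametrization *)
  apply (is_Cint_scal c) in HI.
  unfold Cint_from_infty. fold d.
  rewrite (is_Cint_unique (fun s : R => p (z + s * d) * Ai_ j (a * (z + s * d)))
    (c * (0 - H (z + 0 * d)))).
  - replace (z + 0 * d) with z by ring.
    transitivity (c * d * H z); [ring|]. rewrite Hcd. unfold H, A.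
    replace (c * a * z) with (c * (a * z)) by ring. ring.
  - apply (is_Cint_ext (fun s : R => c * (d * (p (z + s * d) * A 0%nat (z + s * d)))));
      [|exact HI].
    intros s. unfold Ai_. rewrite Ai_eq_Ai_deriv_0. fold c. unfold A.
    replace (a * (z + s * d) * c) with (c * a * (z + s * d)) by ring.
    transitivity (c * d * (p (z + s * d) * Ai_deriv 0 (c * a * (z + s * d)))); [ring|].
    rewrite Hcd. ring.
Qed.

(** The terms in [F'] cancel, and the coefficient of [F] is a Wronskian of two
    rotated Airy functions. *)
Lemma variation_of_parameters (i j : Z) (z : C) :
  let di := cis (2 * PI * IZR i / 3) in
  let dj := cis (2 * PI * IZR j / 3) in
  let ci := cis (- (2 * PI * IZR i / 3)) in
  let cj := cis (- (2 * PI * IZR j / 3)) in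
  ci * (ci * ci) = 1 -> cj * (cj * cj) = 1 ->
  moderate (fun s : R => F (z + s * di)) ->
  moderate (fun s : R => F' (z + s * di)) ->
  moderate (fun s : R => F (z + s * dj)) ->
  moderate (fun s : R => F' (z + s * dj)) ->
  Ai_ i (a * z) *
    Cint_from_infty (2 * PI * IZR j / 3) (fun t => p t * Ai_ j (a * t)) z -
  Ai_ j (a * z) *
    Cint_from_infty (2 * PI * IZR i / 3) (fun t => p t * Ai_ i (a * t)) z
  = a * ((cj - ci) / (2 * PI * sqrt 3)) * F z.
Proof.
  intros di dj ci cj Hci Hcj H1 H2 H3 H4.
  rewrite !ray_integral by assumption. fold ci cj.
  unfold Ai_. rewrite !Ai_eq_Ai_deriv_0. fold ci cj.
  rewrite <- (Ai_wronskian cj ci (a * z) Hcj Hci).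
  rewrite (Cmult_comm (a * z) ci), (Cmult_comm (a * z) cj). ring.
Qed.

End Representation.

Lemma cis_PI6_omega : cis (PI / 6) * (1 - omega) = sqrt 3.
Proof.
  assert (Hs2 : (sqrt 3 * sqrt 3 = 3)%R) by (apply sqrt_sqrt; lra).
  rewrite omega_alt, cis_alt, cos_PI6, sin_PI6.
  unfold Cminus, Copp, Cplus, Cmult, RtoC; simpl. f_equal; [field|].
  replace (sqrt 3 / 2 * (0 + - (sqrt 3 / 2)) + 1 / 2 * (1 + - - / 2))%R
    with ((3 - sqrt 3 * sqrt 3) / 4)%R by field.
  rewrite Hs2. field.
Qed.

Lemma cis_opp_PI6_omega : cis (- (PI / 6)) * (1 - omega * omega) = sqrt 3.
Proof.
  assert (Hs2 : (sqrt 3 * sqrt 3 = 3)%R) by (apply sqrt_sqrt; lra).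
  replace (1 - omega * omega) with (2 + omega).
  - rewrite omega_alt, cis_alt, cos_neg, sin_neg, cos_PI6, sin_PI6.
    unfold Cplus, Cmult, RtoC; simpl. f_equal; [field|].
    replace (sqrt 3 / 2 * (0 + sqrt 3 / 2) + - (1 / 2) * (2 + - / 2))%R
      with ((sqrt 3 * sqrt 3 - 3) / 4)%R by field.
    rewrite Hs2. field.
  - transitivity (1 - omega * omega + (1 + omega + omega * omega)); [ring|].
    rewrite omega_sum. ring.
Qed.

Lemma cis_index_0 : cis (2 * PI * IZR 0 / 3) = 1.
Proof. replace (2 * PI * IZR 0 / 3)%R with 0%R by field. apply cis_0. Qed.

Lemma cis_index_1 : cis (2 * PI * IZR 1 / 3) = omega.
Proof. unfold omega. f_equal. field. Qed.

Lemma cis_index_m1 : cis (2 * PI * IZR (-1) / 3) = omega * omega.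
Proof. rewrite <- cis_opp_2PI3. f_equal. field. Qed.

Lemma cis_opp_index_0 : cis (- (2 * PI * IZR 0 / 3)) = 1.
Proof. replace (- (2 * PI * IZR 0 / 3))%R with 0%R by field. apply cis_0. Qed.

Lemma cis_opp_index_1 : cis (- (2 * PI * IZR 1 / 3)) = omega * omega.
Proof. rewrite <- cis_opp_2PI3. f_equal. field. Qed.

Lemma cis_opp_index_m1 : cis (- (2 * PI * IZR (-1) / 3)) = omega.
Proof. unfold omega. f_equal. field. Qed.

Lemma omega2_cube : omega * omega * (omega * omega * (omega * omega)) = 1.
Proof.
  transitivity ((omega * (omega * omega)) * (omega * (omega * omega))); [ring|].
  rewrite omega_cube. ring.
Qed.

(** The cube root of unity [c] for which [Wi jk x] is [c * moment 0 (c * x)].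
    Where [Re (c d) < 0], this function is bounded in the direction [d]. *)
Definition Wi_rotation (jk : index_pair) : C :=
  match jk with
  | pair_m1_1 => 1
  | pair_0_1 => omega
  | pair_m1_0 => omega * omega
  end.

Lemma Wi_rotation_cube (jk : index_pair) :
  Wi_rotation jk * (Wi_rotation jk * Wi_rotation jk) = 1.
Proof.
  destruct jk; simpl; [ring|apply omega2_cube|apply omega_cube].
Qed.

(** Both directions of integration [d] that belong to the pair [jk] satisfy
    [Re (c d) = - 1/2] for [c = Wi_rotation jk], so the growth hypothesis covers
    what [variation_of_parameters] asks for. *)
Lemma w_eq_moderate_solution (p : nat -> C) (N : nat) (u : R) (jk : index_pair)
   (dp F F' F'' : C -> C) (z : C) :
  (0 < u)%R ->
  (forall z, Cderiv (poly_eval p N) z (dp z)) ->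
  (forall z, Cderiv F z (F' z)) ->
  (forall z, Cderiv F' z (F'' z)) ->
  (forall z, F'' z - u ^ 2 * z * F z = poly_eval p N z) ->
  (forall d : C, (Re (Wi_rotation jk * d) < 0)%R ->
    moderate (fun s : R => F (z + s * d)) /\ moderate (fun s : R => F' (z + s * d))) ->
  w p N jk u z = F z.
Proof.
  intros Hu Hp HF HF' Hode Hmod.
  set (a := Rpower u (2 / 3)).
  assert (Hs : (0 < sqrt 3)%R) by (apply sqrt_lt_R0; lra).
  assert (Hs2 : (sqrt 3 * sqrt 3 = 3)%R) by (apply sqrt_sqrt; lra).
  assert (HsC : RtoC (sqrt 3) <> 0) by (intros H; apply RtoC_inj in H; lra).
  assert (Ha : RtoC (Rpower u (- (2 / 3))) * a = 1).
  { unfold a. rewrite <- RtoC_mult, <- Rpower_plus.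
    replace (- (2 / 3) + 2 / 3)%R with 0%R by field. now rewrite Rpower_O. }
  assert (Hm : forall j : Z, (Re (Wi_rotation jk * cis (2 * PI * IZR j / 3)) < 0)%R ->
    moderate (fun s : R => F (z + s * cis (2 * PI * IZR j / 3))) /\
    moderate (fun s : R => F' (z + s * cis (2 * PI * IZR j / 3)))).
  { intros j. apply Hmod. }
  assert (Hfin : forall C0 D0 : C, C0 * D0 = 2 * PI * sqrt 3 ->
    C0 * Rpower u (- (2 / 3)) * (a * (D0 / (2 * PI * sqrt 3)) * F z) = F z).
  { intros C0 D0 HCD.
    transitivity (C0 * D0 / (2 * PI * sqrt 3) * (Rpower u (- (2 / 3)) * a) * F z).
    - unfold Cdiv. ring.
    - rewrite HCD, Ha. field. split; [exact HsC|apply RtoC_PI_neq_0]. }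
  assert (Ro := Re_omega). assert (Ro2 := Re_omega2).
  unfold w. cbv zeta. fold a.
  destruct jk; unfold Wi_rotation in Hm.
  - destruct (Hm 1%Z) as [M1 M2].
    { rewrite cis_index_1, Cmult_1_l. lra. }
    destruct (Hm (-1)%Z) as [M3 M4].
    { rewrite cis_index_m1, Cmult_1_l. lra. }
    unfold a.
    rewrite (variation_of_parameters u (poly_eval p N) dp F F' F'' Hu Hp HF HF' Hode (-1) 1); trivial.
    + apply Hfin. rewrite cis_opp_index_1, cis_opp_index_m1.
      transitivity (- (2 * PI * Ci * (omega - omega * omega))); [ring|].
      rewrite omega_diff.
      transitivity (2 * PI * sqrt 3 * - (Ci * Ci)); [ring|].
      replace (Ci * Ci) with (- (1)); [ring|].
      unfold Ci, Cmult, Copp, RtoC; simpl. f_equal; ring.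
    + rewrite cis_opp_index_m1. apply omega_cube.
    + rewrite cis_opp_index_1. apply omega2_cube.
  - destruct (Hm 0%Z) as [M1 M2].
    { rewrite cis_index_0, Cmult_1_r. lra. }
    destruct (Hm (-1)%Z) as [M3 M4].
    { rewrite cis_index_m1.
      replace (omega * omega * (omega * omega)) with (omega * (omega * omega) * omega) by ring.
      rewrite omega_cube, Cmult_1_l. lra. }
    unfold a.
    rewrite (variation_of_parameters u (poly_eval p N) dp F F' F'' Hu Hp HF HF' Hode (-1) 0); trivial.
    + apply Hfin. rewrite cis_opp_index_0, cis_opp_index_m1.
      rewrite <- cis_PI6_omega. ring.
    + rewrite cis_opp_index_m1. apply omega_cube.
    + rewrite cis_opp_index_0. ring.
  - destruct (Hm 0%Z) as [M1 M2].
    { rewrite cis_index_0, Cmult_1_r. lra. }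
    destruct (Hm 1%Z) as [M3 M4].
    { rewrite cis_index_1. lra. }
    unfold a.
    rewrite (variation_of_parameters u (poly_eval p N) dp F F' F'' Hu Hp HF HF' Hode 1 0); trivial.
    + apply Hfin. rewrite cis_opp_index_0, cis_opp_index_1.
      rewrite <- cis_opp_PI6_omega. ring.
    + rewrite cis_opp_index_1. apply omega2_cube.
    + rewrite cis_opp_index_0. ring.
Qed.

(** * The polynomial part of the solution *)

(** A sum built by [sum_n] lives in the carrier of a monoid structure, which [ring]
    does not recognize as [C]. *)
Ltac C_eq := lazymatch goal with |- @eq _ ?a ?b => change (@eq C a b) end.

Ltac C_ring := C_eq; ring.
Ltac C_field := C_eq; field.

Lemma Csum_O (f : nat -> C) : sum_n f 0 = f 0%nat.
Proof. apply sum_O. Qed.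

Lemma Csum_S (f : nat -> C) (n : nat) : sum_n f (S n) = sum_n f n + f (S n).
Proof. apply (sum_Sn (G := C_AbelianMonoid)). Qed.

Lemma Csum_ext (f g : nat -> C) (n : nat) :
  (forall k, (k <= n)%nat -> f k = g k) -> sum_n f n = sum_n g n.
Proof. apply (sum_n_ext_loc (G := C_AbelianMonoid)). Qed.

Lemma Csum_plus (f g : nat -> C) (n : nat) :
  sum_n (fun k => f k + g k) n = sum_n f n + sum_n g n.
Proof.
  induction n as [|n IH]; [now rewrite !Csum_O|].
  rewrite !Csum_S, IH. C_ring.
Qed.

Lemma Csum_scal (c : C) (f : nat -> C) (n : nat) :
  sum_n (fun k => c * f k) n = c * sum_n f n.
Proof.
  induction n as [|n IH]; [now rewrite !Csum_O|].
  rewrite !Csum_S, IH. C_ring.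
Qed.

Lemma Csum_extend (f : nat -> C) (n m : nat) : (n <= m)%nat ->
  (forall k, (n < k)%nat -> f k = 0) -> sum_n f m = sum_n f n.
Proof.
  intros Hnm H. induction Hnm as [|m Hm IH]; [reflexivity|].
  rewrite Csum_S, IH, H by lia. C_ring.
Qed.

Lemma Csum_single (f : nat -> C) (k n : nat) :
  sum_n (fun r => if (r =? k)%nat then f r else RtoC 0) n = if (k <=? n)%nat then f k else RtoC 0.
Proof.
  induction n as [|n IH].
  - rewrite Csum_O. destruct k; reflexivity.
  - rewrite Csum_S, IH.
    destruct (Nat.eqb_spec (S n) k) as [<-|Hk].
    + rewrite (proj2 (Nat.leb_gt (S n) n)), Nat.leb_refl by lia. C_ring.
    + destruct (Nat.leb_spec k n); destruct (Nat.leb_spec k (S n)); try lia; C_ring.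
Qed.

Lemma Csum_drop (f : nat -> C) (k n : nat) : (k <= n)%nat ->
  (forall r, (r < k)%nat -> f r = 0) -> sum_n f n = sum_n_m f k n.
Proof.
  intros Hkn Hf. unfold sum_n. induction k as [|k IH]; [reflexivity|].
  rewrite IH; [|lia|intros r Hr; apply Hf; lia].
  rewrite (sum_Sn_m (G := C_AbelianMonoid)) by lia.
  rewrite Hf by lia. apply (plus_zero_l (G := C_AbelianMonoid)).
Qed.

(** The coefficient of [z^(r-1-3s)] produced by [s] steps of the recursion
    [z^(-1) (d/dz)^2] from [z^(r-1)]. *)
Fixpoint ghat_factor (s r : nat) : R :=
  match s with
  | O => 1
  | S s' => ghat_factor s' r * (INR r - 1 - 3 * INR s') * (INR r - 2 - 3 * INR s')
  end.

(** The product is built from the largest factor downwards, so this extracts its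
    first pair of factors instead of its last. *)
Lemma ghat_factor_shift (s r : nat) :
  ghat_factor (S s) (r + 3) = ((INR r + 2) * (INR r + 1) * ghat_factor s r)%R.
Proof.
  assert (E : INR (r + 3) = (INR r + 3)%R) by (rewrite plus_INR; simpl; ring).
  induction s as [|s IH].
  - simpl. rewrite E. ring.
  - change (ghat_factor (S (S s)) (r + 3)) with
      (ghat_factor (S s) (r + 3) * (INR (r + 3) - 1 - 3 * INR (S s)) *
       (INR (r + 3) - 2 - 3 * INR (S s)))%R.
    rewrite IH, E, S_INR. simpl ghat_factor. ring.
Qed.

(** The product of the integers below [3 s] that are not divisible by 3. *)
Lemma ghat_factor_diag (s : nat) :
  ghat_factor s (3 * s) = (INR (fact (3 * s)) / (3 ^ s * INR (fact s)))%R.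
Proof.
  induction s as [|s IH].
  - simpl. field.
  - replace (3 * S s)%nat with (3 * s + 3)%nat by lia.
    rewrite ghat_factor_shift, IH.
    replace (3 * s + 3)%nat with (S (S (S (3 * s)))) by lia.
    rewrite !fact_simpl, !mult_INR, !S_INR, mult_INR.
    simpl pow. simpl (INR 3). simpl (INR 0).
    pose proof (INR_fact_neq_0 s). pose proof (pos_INR s).
    assert (3 ^ s <> 0)%R by (apply pow_nonzero; lra).
    field. repeat split; try assumption; lra.
Qed.

(** Contribution of the monomial [z^r] of [p] to the regular part of [Ghat s];
    the guard says that the exponent is nonnegative. *)
Definition regular_mono (s r : nat) (z : C) : C :=
  if (3 * s + 1 <=? r)%nat then - ghat_factor s r * z ^ (r - 1 - 3 * s) else 0.

Definition regular_mono1 (s r : nat) (z : C) : C :=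
  if (3 * s + 1 <=? r)%nat then
    - ghat_factor s r * (INR (r - 1 - 3 * s) * z ^ (r - 1 - 3 * s - 1)) else 0.

Definition regular_mono2 (s r : nat) (z : C) : C :=
  if (3 * s + 1 <=? r)%nat then
    - ghat_factor s r * (INR (r - 1 - 3 * s) * (INR (r - 1 - 3 * s - 1)
      * z ^ (r - 1 - 3 * s - 1 - 1))) else 0.

Lemma Cderiv_regular_mono (s r : nat) (z : C) : Cderiv (regular_mono s r) z (regular_mono1 s r z).
Proof.
  unfold regular_mono, regular_mono1. destruct (3 * s + 1 <=? r)%nat.
  - apply Cderiv_scal, Cderiv_pow.
  - apply Cderiv_const.
Qed.

Lemma Cderiv_regular_mono1 (s r : nat) (z : C) : Cderiv (regular_mono1 s r) z (regular_mono2 s r z).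
Proof.
  unfold regular_mono1, regular_mono2. destruct (3 * s + 1 <=? r)%nat.
  - apply Cderiv_scal, Cderiv_scal, Cderiv_pow.
  - apply Cderiv_const.
Qed.

(** Taking regular parts does not commute with one step of the recursion: the
    monomial [z^2] has second derivative 2, whose quotient by [z] is singular.
    This happens for [r = 3 (s + 1)] and is the source of [gamma]. *)
Lemma regular_mono2_eq (s r : nat) (z : C) :
  regular_mono2 s r z =
  z * regular_mono (S s) r z - (if (r =? 3 * S s)%nat then RtoC (ghat_factor (S s) r) else 0).
Proof.
  unfold regular_mono2, regular_mono.
  destruct (Nat.leb_spec (3 * s + 1) r) as [H|H].
  2:{ destruct (Nat.leb_spec (3 * S s + 1) r); [lia|].
      destruct (Nat.eqb_spec r (3 * S s)); [lia|]. ring. }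
  set (e := (r - 1 - 3 * s)%nat).
  assert (Er : INR r = (INR e + 1 + 3 * INR s)%R).
  { replace r with (e + 1 + 3 * s)%nat by lia.
    rewrite !plus_INR, mult_INR. simpl. ring. }
  simpl ghat_factor. rewrite Er.
  replace (INR e + 1 + 3 * INR s - 1 - 3 * INR s)%R with (INR e) by ring.
  replace (INR e + 1 + 3 * INR s - 2 - 3 * INR s)%R with (INR e - 1)%R by ring.
  rewrite !RtoC_mult, RtoC_minus.
  destruct (Nat.leb_spec (3 * S s + 1) r).
  - destruct (Nat.eqb_spec r (3 * S s)); [lia|].
    replace (e - 1 - 1)%nat with (S (r - 1 - 3 * S s)) by lia.
    rewrite Cpow_S, minus_INR by lia. rewrite RtoC_minus. simpl (INR 1). ring.
  - destruct (Nat.eqb_spec r (3 * S s)).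
    + replace e with 2%nat by lia. simpl. rewrite RtoC_plus. ring.
    + assert (He : e = 0%nat \/ e = 1%nat) by lia.
      destruct He as [-> | ->]; simpl; ring.
Qed.

Section Polynomials.

Variables (p : nat -> C) (N : nat).

Definition ghat_star (s : nat) (z : C) : C := sum_n (fun r => p r * regular_mono s r z) N.
Definition ghat_star1 (s : nat) (z : C) : C := sum_n (fun r => p r * regular_mono1 s r z) N.
Definition ghat_star2 (s : nat) (z : C) : C := sum_n (fun r => p r * regular_mono2 s r z) N.

Lemma Cderiv_ghat_star (s : nat) (z : C) : Cderiv (ghat_star s) z (ghat_star1 s z).
Proof.
  apply (Cderiv_sum_n (fun r z => p r * regular_mono s r z) (fun r z => p r * regular_mono1 s r z)).
  intros r _. apply Cderiv_scal, Cderiv_regular_mono.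
Qed.

Lemma Cderiv_ghat_star1 (s : nat) (z : C) : Cderiv (ghat_star1 s) z (ghat_star2 s z).
Proof.
  apply (Cderiv_sum_n (fun r z => p r * regular_mono1 s r z) (fun r z => p r * regular_mono2 s r z)).
  intros r _. apply Cderiv_scal, Cderiv_regular_mono1.
Qed.

(** The constant lost in the step from [s - 1] to [s]; for [s = 0] it is the
    constant coefficient of [p]. *)
Definition residue (s : nat) : C :=
  if (3 * s <=? N)%nat then p (3 * s)%nat * ghat_factor s (3 * s) else 0.

Lemma residue_sum (s : nat) :
  residue s = sum_n (fun r => if (r =? 3 * s)%nat then p r * ghat_factor s r else RtoC 0) N.
Proof. unfold residue. now rewrite Csum_single. Qed.

Lemma ghat_star2_eq (s : nat) (z : C) :
  ghat_star2 s z = z * ghat_star (S s) z - residue (S s).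
Proof.
  rewrite residue_sum. unfold ghat_star2, ghat_star.
  transitivity (sum_n (fun r => z * (p r * regular_mono (S s) r z) + - (1) *
     (if (r =? 3 * S s)%nat then p r * ghat_factor (S s) r else RtoC 0)) N).
  - apply Csum_ext. intros r _. rewrite regular_mono2_eq.
    destruct (r =? 3 * S s)%nat; C_ring.
  - rewrite Csum_plus, !Csum_scal.
    match goal with |- ?A + ?m * ?B = _ =>
      transitivity (A - B); [C_ring|reflexivity] end.
Qed.

Lemma mult_ghat_star_0 (z : C) : z * ghat_star 0 z = - (poly_eval p N z - residue 0).
Proof.
  rewrite residue_sum. unfold poly_eval, ghat_star.
  transitivity (sum_n (fun r => - (1) * (p r * z ^ r) +
     (if (r =? 3 * 0)%nat then p r * ghat_factor 0 r else RtoC 0)) N).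
  - rewrite <- Csum_scal. apply Csum_ext. intros r _. unfold regular_mono.
    destruct r as [|r]; simpl; [C_ring|]. rewrite !Nat.sub_0_r. C_ring.
  - rewrite Csum_plus, Csum_scal.
    match goal with |- ?m * ?A + ?B = _ =>
      transitivity (- (A - B)); [C_ring|reflexivity] end.
Qed.

Lemma ghat_star_vanishes (s : nat) (z : C) : (N < 3 * s + 1)%nat -> ghat_star s z = 0.
Proof.
  intros H. unfold ghat_star.
  transitivity (sum_n (fun r : nat => 0 * RtoC 0) N).
  - apply Csum_ext. intros r Hr. unfold regular_mono.
    destruct (Nat.leb_spec (3 * s + 1) r); [lia|]. C_ring.
  - rewrite (Csum_scal 0). C_ring.
Qed.

(** The upper limit [N] is generous: the terms with [3 s >= N] vanish. *)
Definition calG (u : R) (z : C) : C := sum_n (fun s => / u ^ (2 * s + 2) * ghat_star s z) N.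
Definition calG1 (u : R) (z : C) : C := sum_n (fun s => / u ^ (2 * s + 2) * ghat_star1 s z) N.
Definition calG2 (u : R) (z : C) : C := sum_n (fun s => / u ^ (2 * s + 2) * ghat_star2 s z) N.

Lemma Cderiv_calG (u : R) (z : C) : Cderiv (calG u) z (calG1 u z).
Proof.
  apply (Cderiv_sum_n (fun s z => / u ^ (2 * s + 2) * ghat_star s z)
    (fun s z => / u ^ (2 * s + 2) * ghat_star1 s z)).
  intros s _. apply Cderiv_scal, Cderiv_ghat_star.
Qed.

Lemma Cderiv_calG1 (u : R) (z : C) : Cderiv (calG1 u) z (calG2 u z).
Proof.
  apply (Cderiv_sum_n (fun s z => / u ^ (2 * s + 2) * ghat_star1 s z)
    (fun s z => / u ^ (2 * s + 2) * ghat_star2 s z)).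
  intros s _. apply Cderiv_scal, Cderiv_ghat_star1.
Qed.

(** By [ghat_star2_eq] the second derivative of each term cancels against the
    following one multiplied by [u^2 z], up to the residues. *)
Lemma calG_telescope (u : R) (z : C) (n : nat) : (0 < u)%R ->
  sum_n (fun s => / u ^ (2 * s + 2) * ghat_star2 s z) n
  - u ^ 2 * z * sum_n (fun s => / u ^ (2 * s + 2) * ghat_star s z) n
  = poly_eval p N z - sum_n (fun s => / u ^ (2 * s) * residue s) (S n)
    + / u ^ (2 * n + 2) * (z * ghat_star (S n) z).
Proof.
  intros Hu.
  assert (HuC : RtoC u <> 0) by (intros H; apply RtoC_inj in H; lra).
  assert (Hpow : forall k, RtoC u ^ k <> 0) by (intros k; now apply Cpow_nz).
  induction n as [|n IH].
  - rewrite !Csum_S, !Csum_O, ghat_star2_eq.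
    transitivity (/ u ^ 2 * (z * ghat_star 1 z - residue 1) - z * ghat_star 0 z).
    + simpl. C_field. exact HuC.
    + rewrite mult_ghat_star_0. simpl. C_field. exact HuC.
  - rewrite (Csum_S _ n), (Csum_S _ n), (Csum_S _ (S n)).
    rewrite ghat_star2_eq.
    replace (2 * S (S n))%nat with (2 * S n + 2)%nat by lia.
    match goal with |- (?A + ?B) - ?c * (?D + ?E) = _ =>
      transitivity ((A - c * D) + (B - c * E)); [C_ring|] end.
    rewrite IH.
    replace (2 * S n + 2)%nat with (S (S (2 * n + 2))) by lia.
    rewrite !Cpow_S.
    replace (u ^ 2) with (RtoC u * u) by (simpl; C_ring).
    C_field. split; [apply Hpow|exact HuC].
Qed.

Definition residue_total (u : R) : C :=
  sum_n (fun s => / u ^ (2 * s) * residue s) (N / 3).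

Lemma calG_ode (u : R) (z : C) : (0 < u)%R ->
  calG2 u z - u ^ 2 * z * calG u z = poly_eval p N z - residue_total u.
Proof.
  intros Hu. unfold calG2, calG, residue_total.
  rewrite calG_telescope by exact Hu.
  rewrite (ghat_star_vanishes (S N)) by lia.
  rewrite (Csum_extend _ (N / 3) (S N)).
  - C_ring.
  - pose proof (Nat.Div0.div_le_upper_bound N 3 N). lia.
  - intros k Hk. unfold residue.
    destruct (Nat.leb_spec (3 * k) N) as [H|H]; [|C_ring].
    exfalso. apply (Nat.div_le_lower_bound N 3 k) in H; lia.
Qed.

Lemma gamma_residue (u : R) : (0 < u)%R ->
  gamma p N u = / Rpower u (4 / 3) * residue_total u.
Proof.
  intros Hu. unfold gamma, residue_total. f_equal.
  assert (HuC : RtoC u <> 0) by (intros H; apply RtoC_inj in H; lra).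
  apply Csum_ext. intros s Hs. unfold residue.
  destruct (Nat.leb_spec (3 * s) N) as [H|H].
  2:{ exfalso. pose proof (Nat.Div0.mul_div_le N 3). lia. }
  rewrite ghat_factor_diag.
  assert (H3 : (3 ^ s <> 0)%R) by (apply pow_nonzero; lra).
  pose proof (INR_fact_neq_0 s) as Hf.
  assert (H3f : (3 ^ s * INR (fact s) <> 0)%R) by now apply Rmult_integral_contrapositive.
  rewrite RtoC_div by exact H3f.
  rewrite RtoC_mult, RtoC_pow.
  assert (H3C : RtoC 3 ^ s <> 0).
  { apply Cpow_nz. intros E. apply RtoC_inj in E. lra. }
  assert (HfC : RtoC (INR (fact s)) <> 0).
  { intros E. apply RtoC_inj in E. contradiction. }
  pose proof (Cpow_nz u (2 * s) HuC) as Hup.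
  set (v := RtoC u ^ (2 * s)) in *. set (t := RtoC 3 ^ s) in *.
  C_field. repeat split; assumption.
Qed.

End Polynomials.

(** * Laurent expansions of the formal coefficients *)

Lemma is_series_single (k : nat) (c : C) :
  is_series (K := C_AbsRing) (V := C_NormedModule)
    (fun n => if (n =? k)%nat then c else RtoC 0) c.
Proof.
  unfold is_series.
  apply (filterlim_ext_loc (fun _ => c)); [|apply filterlim_const].
  exists k. intros n Hn.
  change (c = sum_n (fun n : nat => if (n =? k)%nat then c else RtoC 0) n).
  rewrite (Csum_single (fun _ => c)).
  now rewrite (proj2 (Nat.leb_le k n) Hn).
Qed.

Lemma is_regular_part_ext (f f' g g' : C -> C) :
  (forall z : C, z <> 0 -> f z = f' z) -> (forall z, g z = g' z) ->
  is_regular_part f g -> is_regular_part f' g'.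
Proof.
  intros Hf Hg [a [b [Ha Hb]]]. exists a, b. split.
  - intros z. rewrite <- Hg. apply Ha.
  - intros z Hz. rewrite <- Hg, <- Hf by exact Hz. now apply Hb.
Qed.

Lemma is_regular_part_plus (f f' g g' : C -> C) :
  is_regular_part f g -> is_regular_part f' g' ->
  is_regular_part (fun z => f z + f' z) (fun z => g z + g' z).
Proof.
  intros [a [b [Ha Hb]]] [a' [b' [Ha' Hb']]].
  exists (fun n => a n + a' n), (fun n => b n + b' n). split.
  - intros z.
    exact (is_pseries_plus (K := C_AbsRing) (V := C_NormedModule) a a' z _ _ (Ha z) (Ha' z)).
  - intros z Hz.
    pose proof (is_series_plus (K := C_AbsRing) (V := C_NormedModule) _ _ _ _
      (Hb z Hz) (Hb' z Hz)) as H.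
    replace (f z + f' z - (g z + g' z)) with (f z - g z + (f' z - g' z)) by ring.
    eapply is_series_ext; [|exact H].
    intros n. change (b n / z ^ S n + b' n / z ^ S n = (b n + b' n) / z ^ S n).
    unfold Cdiv. ring.
Qed.

Lemma is_regular_part_scal (c : C) (f g : C -> C) :
  is_regular_part f g -> is_regular_part (fun z => c * f z) (fun z => c * g z).
Proof.
  intros [a [b [Ha Hb]]].
  exists (fun n => c * a n), (fun n => c * b n). split.
  - intros z. pose proof (is_series_scal (K := C_AbsRing) (V := C_NormedModule) c _ _ (Ha z)) as H.
    eapply is_series_ext; [|exact H].
    intros n.
    change (c * (z ^ n * a n) = z ^ n * (c * a n)). ring.
  - intros z Hz. pose proof (is_series_scal (K := C_AbsRing) (V := C_NormedModule) c _ _ (Hb z Hz)) as H.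
    replace (c * f z - c * g z) with (c * (f z - g z)) by ring.
    eapply is_series_ext; [|exact H].
    intros n. change (c * (b n / z ^ S n) = c * b n / z ^ S n).
    unfold Cdiv. ring.
Qed.

Lemma is_regular_part_sum (f g : nat -> C -> C) (n : nat) :
  (forall k, is_regular_part (f k) (g k)) ->
  is_regular_part (fun z => sum_n (fun k => f k z) n) (fun z => sum_n (fun k => g k z) n).
Proof.
  intros H. induction n as [|n IH].
  - apply (is_regular_part_ext (f 0%nat) _ (g 0%nat) _); [| |apply H];
      intros; now rewrite Csum_O.
  - eapply is_regular_part_ext; [| |exact (is_regular_part_plus _ _ _ _ IH (H (S n)))];
      intros; now rewrite Csum_S.
Qed.

Lemma is_regular_part_pow (n : nat) : is_regular_part (fun z => z ^ n) (fun z => z ^ n).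
Proof.
  exists (fun k => if (k =? n)%nat then RtoC 1 else RtoC 0), (fun _ => 0). split.
  - intros z. eapply is_series_ext; [|apply (is_series_single n (z ^ n))].
    intros k.
    change ((if (k =? n)%nat then z ^ n else RtoC 0) =
      z ^ k * (if (k =? n)%nat then RtoC 1 else RtoC 0)).
    destruct (Nat.eqb_spec k n) as [->|_]; ring.
  - intros z Hz. replace (z ^ n - z ^ n) with (RtoC 0) by ring.
    eapply is_series_ext; [|apply (is_series_single 0 0)].
    intros k. cbv beta. transitivity (RtoC 0).
    + now destruct (k =? 0)%nat.
    + unfold Cdiv. C_ring.
Qed.

Lemma is_regular_part_inv_pow (n : nat) :
  is_regular_part (fun z => / z ^ S n) (fun _ => 0).
Proof.
  exists (fun _ => 0), (fun k => if (k =? n)%nat then RtoC 1 else RtoC 0). split.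
  - intros z. eapply is_series_ext; [|apply (is_series_single 0 0)].
    intros k.
    change ((if (k =? 0)%nat then RtoC 0 else RtoC 0) = z ^ k * 0).
    destruct (k =? 0)%nat; ring.
  - intros z Hz. replace (/ z ^ S n - 0) with (/ z ^ S n) by ring.
    eapply is_series_ext; [|apply (is_series_single n (/ z ^ S n))].
    intros k. cbv beta. destruct (Nat.eqb_spec k n) as [->|_]; unfold Cdiv; C_ring.
Qed.

Lemma is_regular_part_regular_mono (s r : nat) :
  is_regular_part (fun z => - ghat_factor s r * (z ^ r / z ^ S (3 * s))) (regular_mono s r).
Proof.
  unfold regular_mono. destruct (Nat.leb_spec (3 * s + 1) r) as [H|H].
  - apply is_regular_part_scal.
    eapply is_regular_part_ext; [| |apply (is_regular_part_pow (r - 1 - 3 * s))].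
    + intros z Hz. cbv beta.
      replace r with (r - 1 - 3 * s + S (3 * s))%nat at 2 by lia.
      rewrite Cpow_add_r. field. now apply Cpow_nz.
    + reflexivity.
  - eapply is_regular_part_ext;
      [| |exact (is_regular_part_scal (- ghat_factor s r) _ _ (is_regular_part_inv_pow (3 * s - r)))].
    + intros z Hz. cbv beta. f_equal.
      replace (S (3 * s)) with (r + S (3 * s - r))%nat by lia.
      rewrite (Cpow_add_r z r). field. split; now apply Cpow_nz.
    + intros z. cbv beta. ring.
Qed.

Lemma Cderiv_inv (z : C) : z <> 0 -> Cderiv Cinv z (- / (z * z)).
Proof.
  intros Hz. apply Cderiv_iff. intros eps.
  assert (Hm : (0 < Cmod z)%R) by now apply Cmod_gt_0.
  assert (Hd : (0 < Rmin (Cmod z / 2) (eps * Cmod z ^ 3 / 2))%R).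
  { apply Rmin_glb_lt; [lra|]. apply Rdiv_lt_0_compat; [|lra].
    apply Rmult_lt_0_compat; [apply cond_pos|now apply pow_lt]. }
  exists (mkposreal _ Hd). intros h Hh.
  change (Cmod h < Rmin (Cmod z / 2) (eps * Cmod z ^ 3 / 2))%R in Hh.
  pose proof (Rmin_l (Cmod z / 2) (eps * Cmod z ^ 3 / 2)).
  pose proof (Rmin_r (Cmod z / 2) (eps * Cmod z ^ 3 / 2)).
  assert (Hzh : (Cmod z / 2 <= Cmod (z + h))%R).
  { pose proof (Cmod_minus_le (z + h) h) as H1.
    replace (z + h - h) with z in H1 by ring. lra. }
  assert (Hzh0 : z + h <> 0) by (apply Cmod_gt_0; lra).
  replace (/ (z + h) - / z - h * - / (z * z)) with (h * (h / (z * z * (z + h))))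
    by (field; split; assumption).
  rewrite Cmod_mult, Cmod_div, !Cmod_mult by (apply Cmult_neq_0; [apply Cmult_neq_0|]; assumption).
  rewrite Rmult_comm. apply Rmult_le_compat_r; [apply Cmod_ge_0|].
  apply Rle_trans with (Cmod h / (Cmod z * Cmod z * (Cmod z / 2)))%R.
  - unfold Rdiv at 1 2. apply Rmult_le_compat_l; [apply Cmod_ge_0|].
    apply Rinv_le_contravar.
    + apply Rmult_lt_0_compat; nra.
    + apply Rmult_le_compat_l; nra.
  - apply (Rmult_le_reg_r (Cmod z * Cmod z * (Cmod z / 2))).
    + apply Rmult_lt_0_compat; nra.
    + replace (Cmod h / (Cmod z * Cmod z * (Cmod z / 2)) * (Cmod z * Cmod z * (Cmod z / 2)))%R
        with (Cmod h) by (field; lra).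
      replace (eps * (Cmod z * Cmod z * (Cmod z / 2)))%R with (eps * Cmod z ^ 3 / 2)%R
        by field. lra.
Qed.

Lemma Cderiv_laurent (r k : nat) (z : C) : z <> 0 ->
  Cderiv (fun z => z ^ r / z ^ k) z ((INR r - INR k) * (z ^ r / z ^ S k)).
Proof.
  intros Hz.
  assert (Hk : forall n, z ^ n <> 0) by (intros n; now apply Cpow_nz).
  eapply Cderiv_eq.
  - apply Cderiv_mult; [apply Cderiv_pow|].
    apply (Cderiv_comp Cinv (fun z => z ^ k)); [apply Cderiv_inv, Hk|apply Cderiv_pow].
  - cbv beta. unfold Cdiv.
    destruct r as [|r]; destruct k as [|k].
    + simpl. field. exact Hz.
    + replace (S k - 1)%nat with k by lia. rewrite !Cpow_S. simpl (z ^ 0). simpl (INR 0).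
      field. split; [apply Hk|exact Hz].
    + replace (S r - 1)%nat with r by lia. rewrite !Cpow_S. simpl (z ^ 0). simpl (INR 0).
      field. exact Hz.
    + replace (S k - 1)%nat with k by lia. replace (S r - 1)%nat with r by lia.
      rewrite !Cpow_S. field. split; [apply Hk|exact Hz].
Qed.

(** The derivative at [z] depends on values near [z] only, so an identity valid
    away from the origin can be differentiated repeatedly. *)
Lemma C_derive_punctured (f g : C -> C) (z l : C) :
  (forall x : C, x <> 0 -> f x = g x) -> z <> 0 -> Cderiv g z l -> C_derive f z = l.
Proof.
  intros Hfg Hz Hg. apply is_C_derive_unique.
  eapply is_derive_ext_loc; [|exact Hg].
  assert (Hm : (0 < Cmod z)%R) by now apply Cmod_gt_0.
  exists (mkposreal _ Hm). intros y Hy.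
  change (Cmod (y - z)%C < Cmod z)%R in Hy.
  symmetry. apply Hfg. intros E. rewrite E in Hy.
  replace (0 - z) with (- z) in Hy by ring. rewrite Cmod_opp in Hy. lra.
Qed.

Lemma Ghat_laurent (p : nat -> C) (N s : nat) (z : C) : z <> 0 ->
  Ghat p N s z = sum_n (fun r => p r * (- ghat_factor s r * (z ^ r / z ^ S (3 * s)))) N.
Proof.
  revert z. induction s as [|s IH]; intros z Hz.
  - simpl Ghat.
    transitivity (sum_n (fun r => - (1) * (p r * (z ^ r / z))) N).
    + rewrite Csum_scal. C_ring.
    + apply Csum_ext. intros r _. replace (z ^ S (3 * 0)) with z by (simpl; ring).
      simpl ghat_factor. C_ring.
  - simpl Ghat.
    assert (H1 : forall x : C, x <> 0 -> C_derive (Ghat p N s) x =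
      sum_n (fun r => p r * (- ghat_factor s r * ((INR r - INR (S (3 * s)))
        * (x ^ r / x ^ S (S (3 * s)))))) N).
    { intros x Hx. eapply C_derive_punctured; [exact IH|exact Hx|].
      apply (Cderiv_sum_n (fun r z => p r * (- ghat_factor s r * (z ^ r / z ^ S (3 * s))))
        (fun r x => p r * (- ghat_factor s r * ((INR r - INR (S (3 * s)))
        * (x ^ r / x ^ S (S (3 * s))))))).
      intros r _. apply Cderiv_scal, Cderiv_scal. now apply Cderiv_laurent. }
    assert (H2 : C_derive (C_derive (Ghat p N s)) z =
      sum_n (fun r => p r * (- ghat_factor s r * ((INR r - INR (S (3 * s))) *
       ((INR r - INR (S (S (3 * s)))) * (z ^ r / z ^ S (S (S (3 * s)))))))) N).
    { eapply C_derive_punctured; [exact H1|exact Hz|].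
      apply (Cderiv_sum_n (fun r x => p r * (- ghat_factor s r * ((INR r - INR (S (3 * s)))
        * (x ^ r / x ^ S (S (3 * s))))))
        (fun r z => p r * (- ghat_factor s r * ((INR r - INR (S (3 * s))) *
       ((INR r - INR (S (S (3 * s)))) * (z ^ r / z ^ S (S (S (3 * s))))))))).
      intros r _. apply Cderiv_scal, Cderiv_scal, Cderiv_scal. now apply Cderiv_laurent. }
    rewrite H2, <- Csum_scal. apply Csum_ext. intros r _.
    replace (3 * S s)%nat with (S (S (S (3 * s)))) by lia.
    simpl ghat_factor. rewrite !RtoC_mult, !RtoC_minus, !S_INR, mult_INR, !RtoC_plus, !RtoC_mult.
    rewrite !Cpow_S. simpl (INR 3). rewrite !RtoC_plus.
    C_field. split; [now apply Cpow_nz|exact Hz].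
Qed.

Lemma ghat_star_regular_part (p : nat -> C) (N s : nat) :
  is_regular_part (Ghat p N s) (ghat_star p N s).
Proof.
  eapply is_regular_part_ext.
  3:{ apply (is_regular_part_sum (fun r z => p r * (- ghat_factor s r * (z ^ r / z ^ S (3 * s))))
       (fun r z => p r * regular_mono s r z) N).
      intros r. apply is_regular_part_scal, is_regular_part_regular_mono. }
  - intros z Hz. symmetry. now apply Ghat_laurent.
  - reflexivity.
Qed.

(** * The connection formula and its expansion *)

(** Bound on the whole plane.  It gives growth along every ray and also bounds on
    discs. *)
Definition poly_growth (f : C -> C) : Prop :=
  exists (n : nat) (K : R), (0 <= K)%R /\
    forall z : C, (Cmod (f z) <= K * (1 + Cmod z) ^ n)%R.

Lemma poly_growth_pow (n : nat) : poly_growth (fun z => z ^ n).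
Proof.
  exists n, 1%R. split; [lra|]. intros z. rewrite Cmod_pow, Rmult_1_l.
  apply pow_incr. pose proof (Cmod_ge_0 z). lra.
Qed.

Lemma poly_growth_0 : poly_growth (fun _ => 0).
Proof. exists 0%nat, 0%R. split; [lra|]. intros z. rewrite Cmod_0. lra. Qed.

Lemma poly_growth_scal (c : C) (f : C -> C) :
  poly_growth f -> poly_growth (fun z => c * f z).
Proof.
  intros [n [K [HK H]]]. exists n, (Cmod c * K)%R.
  pose proof (Cmod_ge_0 c). split; [now apply Rmult_le_pos|].
  intros z. rewrite Cmod_mult, Rmult_assoc. now apply Rmult_le_compat_l.
Qed.

Lemma poly_growth_plus (f g : C -> C) :
  poly_growth f -> poly_growth g -> poly_growth (fun z => f z + g z).
Proof.
  intros [n [K [HK Hf]]] [n' [K' [HK' Hg]]].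
  exists (n + n')%nat, (K + K')%R. split; [lra|]. intros z.
  pose proof (Cmod_ge_0 z) as Hz.
  eapply Rle_trans; [apply Cmod_triangle|].
  rewrite Rmult_plus_distr_r. apply Rplus_le_compat.
  - eapply Rle_trans; [apply Hf|]. apply Rmult_le_compat_l; [exact HK|].
    apply Rle_pow; [lra|lia].
  - eapply Rle_trans; [apply Hg|]. apply Rmult_le_compat_l; [exact HK'|].
    apply Rle_pow; [lra|lia].
Qed.

Lemma poly_growth_sum (f : nat -> C -> C) (n : nat) :
  (forall k, poly_growth (f k)) -> poly_growth (fun z => sum_n (fun k => f k z) n).
Proof.
  intros H. induction n as [|n IH].
  - destruct (H 0%nat) as [m [K [HK Hf]]]. exists m, K. split; [exact HK|].
    intros z. rewrite Csum_O. apply Hf.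
  - destruct (poly_growth_plus _ _ IH (H (S n))) as [m [K [HK Hf]]].
    exists m, K. split; [exact HK|].
    intros z. rewrite Csum_S. apply Hf.
Qed.

Lemma poly_growth_regular_mono (s r : nat) : poly_growth (regular_mono s r).
Proof.
  unfold regular_mono. destruct (3 * s + 1 <=? r)%nat; [|apply poly_growth_0].
  apply poly_growth_scal, poly_growth_pow.
Qed.

Lemma poly_growth_regular_mono1 (s r : nat) : poly_growth (regular_mono1 s r).
Proof.
  unfold regular_mono1. destruct (3 * s + 1 <=? r)%nat; [|apply poly_growth_0].
  apply poly_growth_scal, poly_growth_scal, poly_growth_pow.
Qed.

Lemma poly_growth_ghat_star (p : nat -> C) (N s : nat) : poly_growth (ghat_star p N s).
Proof.
  apply (poly_growth_sum (fun r z => p r * regular_mono s r z)).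
  intros r. apply poly_growth_scal, poly_growth_regular_mono.
Qed.

Lemma poly_growth_ghat_star1 (p : nat -> C) (N s : nat) : poly_growth (ghat_star1 p N s).
Proof.
  apply (poly_growth_sum (fun r z => p r * regular_mono1 s r z)).
  intros r. apply poly_growth_scal, poly_growth_regular_mono1.
Qed.

Lemma poly_growth_calG (p : nat -> C) (N : nat) (u : R) : poly_growth (calG p N u).
Proof.
  apply (poly_growth_sum (fun s z => / u ^ (2 * s + 2) * ghat_star p N s z)).
  intros r. apply poly_growth_scal, poly_growth_ghat_star.
Qed.

Lemma poly_growth_calG1 (p : nat -> C) (N : nat) (u : R) : poly_growth (calG1 p N u).
Proof.
  apply (poly_growth_sum (fun s z => / u ^ (2 * s + 2) * ghat_star1 p N s z)).
  intros r. apply poly_growth_scal, poly_growth_ghat_star1.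
Qed.

Lemma poly_growth_moderate (f : C -> C) (z d : C) :
  poly_growth f -> moderate (fun s : R => f (z + s * d)).
Proof.
  intros [n [K [HK H]]].
  exists n, (K * (1 + Cmod z + Cmod d) ^ n)%R, 1%R. split; [lra|]. intros s Hs.
  eapply Rle_trans; [apply H|]. rewrite Rmult_assoc, <- Rpow_mult_distr.
  apply Rmult_le_compat_l; [exact HK|]. apply pow_incr.
  pose proof (Cmod_ge_0 (z + s * d)). pose proof (Cmod_ge_0 z). pose proof (Cmod_ge_0 d).
  split; [lra|].
  pose proof (Cmod_triangle z (s * d)) as Ht.
  rewrite Cmod_mult, Cmod_R, Rabs_pos_eq in Ht by lra. nra.
Qed.

Lemma moderate_scal (c : C) (f : R -> C) : moderate f -> moderate (fun s => c * f s).
Proof.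
  intros [n [K [T [HT H]]]]. exists n, (Cmod c * K)%R, T. split; [exact HT|].
  intros s Hs. rewrite Cmod_mult, Rmult_assoc.
  apply Rmult_le_compat_l; [apply Cmod_ge_0|now apply H].
Qed.

Lemma moderate_plus (f g : R -> C) :
  moderate f -> moderate g -> moderate (fun s => f s + g s).
Proof.
  intros [n [K [T [HT Hf]]]] [n' [K' [T' [HT' Hg]]]].
  exists (n + n')%nat, (Rabs K + Rabs K')%R, (Rmax 1 (Rmax T T')).
  pose proof (Rmax_l 1 (Rmax T T')). pose proof (Rmax_r 1 (Rmax T T')).
  pose proof (Rmax_l T T'). pose proof (Rmax_r T T').
  split; [lra|]. intros s Hs.
  eapply Rle_trans; [apply Cmod_triangle|].
  rewrite Rmult_plus_distr_r. apply Rplus_le_compat.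
  - eapply Rle_trans; [apply Hf; lra|].
    apply Rle_trans with (Rabs K * s ^ n)%R.
    + apply Rmult_le_compat_r; [apply pow_le; lra|apply Rle_abs].
    + apply Rmult_le_compat_l; [apply Rabs_pos|]. apply Rle_pow; [lra|lia].
  - eapply Rle_trans; [apply Hg; lra|].
    apply Rle_trans with (Rabs K' * s ^ n')%R.
    + apply Rmult_le_compat_r; [apply pow_le; lra|apply Rle_abs].
    + apply Rmult_le_compat_l; [apply Rabs_pos|]. apply Rle_pow; [lra|lia].
Qed.

(** The [k]-th derivative of the scaled Scorer function that belongs to the cube
    root of unity [c]. *)
Definition Wi_deriv (c : C) (k : nat) (x : C) : C := c ^ S k * moment k (c * x).

Lemma Wi_eq_Wi_deriv_0 (jk : index_pair) (x : C) : Wi jk x = Wi_deriv (Wi_rotation jk) 0 x.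
Proof.
  unfold Wi, Wi_deriv. rewrite Cpow_1_r. pose proof RtoC_PI_neq_0.
  destruct jk; simpl Wi_rotation; rewrite !Hi_moment.
  - rewrite !Cmult_1_l. field. assumption.
  - rewrite !cis_opp_2PI3, (Cmult_comm x). field. assumption.
  - fold omega. rewrite (Cmult_comm x). field. assumption.
Qed.

Lemma Cderiv_Wi_deriv (c b : C) (k : nat) (z : C) :
  Cderiv (fun z => Wi_deriv c k (b * z)) z (b * Wi_deriv c (S k) (b * z)).
Proof.
  apply (Cderiv_lin (Wi_deriv c k)). unfold Wi_deriv.
  eapply Cderiv_eq.
  - apply Cderiv_scal, Cderiv_lin, Cderiv_moment.
  - rewrite (Cpow_S c (S k)). ring.
Qed.

Lemma Wi_deriv_ode (c x : C) : c * (c * c) = 1 ->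
  Wi_deriv c 2 x = x * Wi_deriv c 0 x + 1.
Proof.
  intros Hc. unfold Wi_deriv. rewrite moment_rec. simpl.
  transitivity (c * (c * c) * (x * (c * moment 0 (c * x)) + 1)); [ring|].
  rewrite Hc. ring.
Qed.

Lemma moderate_Wi_deriv (c z d : C) (a : R) (k : nat) : (0 < a)%R -> (Re (c * d) < 0)%R ->
  d <> 0 -> moderate (fun s : R => Wi_deriv c k (a * (z + s * d))).
Proof.
  intros Ha Hcd Hd. apply moderate_scal.
  destruct (moment_ray_bound k (c * d) (a * z / d) Hcd) as [B [T H]].
  exists 0%nat, B, (Rmax 1 (T / a)).
  pose proof (Rmax_l 1 (T / a)). pose proof (Rmax_r 1 (T / a)).
  split; [lra|]. intros s Hs. rewrite pow_O, Rmult_1_r.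
  replace (c * (a * (z + s * d))) with (c * d * (a * z / d + (a * s)%R)).
  - apply H. apply (Rmult_le_reg_r (/ a)); [now apply Rinv_0_lt_compat|].
    replace (a * s * / a)%R with s by (field; lra). unfold Rdiv in *. lra.
  - rewrite RtoC_mult. field. exact Hd.
Qed.

Lemma Cderiv_poly_eval (p : nat -> C) (N : nat) (z : C) :
  Cderiv (poly_eval p N) z (sum_n (fun r => p r * (INR r * z ^ (r - 1))) N).
Proof.
  apply (Cderiv_sum_n (fun r z => p r * z ^ r) (fun r z => p r * (INR r * z ^ (r - 1)))).
  intros r _. apply Cderiv_scal, Cderiv_pow.
Qed.

Section Connection.

Variables (p : nat -> C) (N : nat) (u : R) (jk : index_pair).
Hypothesis Hu : (0 < u)%R.

Let a : R := Rpower u (2 / 3).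
Let c : C := Wi_rotation jk.

(** The right-hand side of the connection formula. *)
Definition solution (z : C) : C :=
  gamma p N u * Wi_deriv c 0 (a * z) + calG p N u z.
Definition solution1 (z : C) : C :=
  gamma p N u * (a * Wi_deriv c 1 (a * z)) + calG1 p N u z.
Definition solution2 (z : C) : C :=
  gamma p N u * (a * (a * Wi_deriv c 2 (a * z))) + calG2 p N u z.

Lemma Cderiv_solution (z : C) : Cderiv solution z (solution1 z).
Proof.
  apply Cderiv_plus; [|apply Cderiv_calG]. apply Cderiv_scal.
  apply Cderiv_Wi_deriv.
Qed.

Lemma Cderiv_solution1 (z : C) : Cderiv solution1 z (solution2 z).
Proof.
  apply Cderiv_plus; [|apply Cderiv_calG1]. apply Cderiv_scal, Cderiv_scal.
  apply Cderiv_Wi_deriv.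
Qed.

Lemma solution_ode (z : C) :
  solution2 z - u ^ 2 * z * solution z = poly_eval p N z.
Proof.
  unfold solution2, solution.
  rewrite Wi_deriv_ode by apply Wi_rotation_cube.
  assert (Ha3 : RtoC a * (a * a) = u ^ 2).
  { rewrite <- !RtoC_mult, <- RtoC_pow. f_equal. now apply Rpower_2_3_cube. }
  pose proof (calG_ode p N u z Hu) as HG.
  transitivity (gamma p N u * (a * a) + (calG2 p N u z - u ^ 2 * z * calG p N u z)).
  - rewrite <- Ha3. ring.
  - rewrite HG, gamma_residue by exact Hu.
    assert (Ha2 : (a * a = Rpower u (4 / 3))%R).
    { unfold a. rewrite <- Rpower_plus. f_equal. field. }
    rewrite <- RtoC_mult, Ha2. field.
    intros E. apply RtoC_inj in E. unfold Rpower in E.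
    pose proof (exp_pos (4 / 3 * ln u)). lra.
Qed.

Lemma w_solution (z : C) : w p N jk u z = solution z.
Proof.
  assert (Ha : (0 < a)%R) by (unfold a, Rpower; apply exp_pos).
  apply (w_eq_moderate_solution p N u jk (fun z => sum_n (fun r => p r * (INR r * z ^ (r - 1))) N)
    solution solution1 solution2).
  - exact Hu.
  - apply Cderiv_poly_eval.
  - apply Cderiv_solution.
  - apply Cderiv_solution1.
  - apply solution_ode.
  - intros d Hd.
    assert (Hd0 : d <> 0).
    { intros E. rewrite E, Cmult_0_r, re_RtoC in Hd. lra. }
    split.
    + apply moderate_plus.
      * apply moderate_scal. now apply moderate_Wi_deriv.
      * apply poly_growth_moderate, poly_growth_calG.
    + apply moderate_plus.
      * apply moderate_scal, moderate_scal. now apply moderate_Wi_deriv.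
      * apply poly_growth_moderate, poly_growth_calG1.
Qed.

End Connection.

Lemma ghat_star_sum_from (p : nat -> C) (N s k : nat) (f : nat -> C) (z : C) :
  (k <= N)%nat -> (k <= 3 * s + 1)%nat ->
  (forall r, (k <= r <= N)%nat -> p r * regular_mono s r z = - f r) ->
  ghat_star p N s z = - sum_n_m f k N.
Proof.
  intros HkN Hks Hf. unfold ghat_star.
  rewrite (Csum_drop _ k N HkN).
  - transitivity (sum_n_m (G := C_AbelianMonoid) (fun r => - (1) * f r) k N).
    + apply sum_n_m_ext_loc. intros r Hr. rewrite Hf by exact Hr. C_ring.
    + transitivity (- (1) * sum_n_m f k N); [|C_ring].
      exact (sum_n_m_mult_l (K := C_Ring) (- (1)) f k N).
  - intros r Hr. unfold regular_mono. destruct (Nat.leb_spec (3 * s + 1) r); [lia|]. ring.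
Qed.

Lemma ghat_star_0 (p : nat -> C) (N : nat) (z : C) : (1 <= N)%nat ->
  ghat_star p N 0 z = - sum_n_m (fun r => p r * z ^ (r - 1)) 1 N.
Proof.
  intros HN. apply ghat_star_sum_from; [exact HN|lia|].
  intros r Hr. unfold regular_mono. destruct (Nat.leb_spec (3 * 0 + 1) r); [|lia].
  simpl. rewrite Nat.sub_0_r. ring.
Qed.

Lemma ghat_star_1 (p : nat -> C) (N : nat) (z : C) : (4 <= N)%nat ->
  ghat_star p N 1 z =
  - sum_n_m (fun r => INR ((r - 1) * (r - 2)) * p r * z ^ (r - 4)) 4 N.
Proof.
  intros HN. apply ghat_star_sum_from; [exact HN|lia|].
  intros r Hr. unfold regular_mono. destruct (Nat.leb_spec (3 * 1 + 1) r); [|lia].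
  replace (r - 1 - 3 * 1)%nat with (r - 4)%nat by lia.
  rewrite mult_INR, !minus_INR by lia. simpl.
  rewrite !RtoC_mult, !RtoC_minus, !RtoC_mult, !RtoC_plus. ring.
Qed.

(** For [u >= 1] each further term is of order [u^(-2m-4)], with [m] the last
    index kept, and the number of further terms does not depend on [u]. *)
Lemma calG_tail_bound (p : nat -> C) (N m n : nat) (r0 : R) :
  exists K : R, forall (u : R) (z : C), (1 <= u)%R -> (Cmod z <= r0)%R ->
    (Cmod (sum_n (fun s => / u ^ (2 * s + 2) * ghat_star p N s z) (m + n)
       - sum_n (fun s => / u ^ (2 * s + 2) * ghat_star p N s z) m)%C
      <= K / u ^ (2 * S m + 2))%R.
Proof.
  induction n as [|n [K IH]].
  - exists 0%R. intros u z Hu Hz. rewrite Nat.add_0_r.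
    replace (_ - _) with (RtoC 0) by C_ring.
    rewrite Cmod_0. unfold Rdiv. rewrite Rmult_0_l. lra.
  - destruct (poly_growth_ghat_star p N (S (m + n))) as [d [B [HB H]]].
    exists (K + B * (1 + Rabs r0) ^ d)%R. intros u z Hu Hz.
    specialize (IH u z Hu Hz). specialize (H z).
    replace (m + S n)%nat with (S (m + n)) by lia. rewrite Csum_S.
    match goal with |- (Cmod (?A + ?b - ?C)%C <= _)%R =>
      replace (A + b - C) with ((A - C) + b) by C_ring end.
    eapply Rle_trans; [apply Cmod_triangle|].
    unfold Rdiv. rewrite Rmult_plus_distr_r. apply Rplus_le_compat; [exact IH|].
    assert (Hup : forall k, (0 < u ^ k)%R) by (intros k; apply pow_lt; lra).
    assert (HuC : RtoC u <> 0) by (intros E; apply RtoC_inj in E; lra).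
    rewrite Cmod_mult, Cmod_inv by now apply Cpow_nz.
    rewrite Cmod_pow, Cmod_R, Rabs_pos_eq by lra. rewrite Rmult_comm.
    apply Rmult_le_compat.
    + apply Cmod_ge_0.
    + apply Rlt_le, Rinv_0_lt_compat, Hup.
    + eapply Rle_trans; [exact H|]. apply Rmult_le_compat_l; [exact HB|].
      apply pow_incr. pose proof (Cmod_ge_0 z). pose proof (Rle_abs r0). lra.
    + apply Rinv_le_contravar; [apply Hup|]. apply Rle_pow; [lra|lia].
Qed.

Theorem theorem6p4 (p : nat -> C) (N : nat) (hN : (1 <= N)%nat)
    (hp : p N <> 0) :
  exists (Gstar : nat -> C -> C) (G : R -> C -> C),
    (forall s : nat, is_regular_part (Ghat p N s) (Gstar s)) /\
    (forall z : C,
       Gstar 0%nat z = - sum_n_m (fun r => p r * z ^ (r - 1)) 1 N) /\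
    ((4 <= N)%nat -> forall z : C,
       Gstar 1%nat z =
       - sum_n_m (fun r => INR ((r - 1) * (r - 2)) * p r * z ^ (r - 4)) 4 N) /\
    (forall (u : R), (0 < u)%R -> forall jk : index_pair,
       solves_inhomogeneous_airy p N u (w p N jk u) /\
       forall z : C,
         w p N jk u z =
         gamma p N u * Wi jk (Rpower u (2 / 3) * z) + G u z) /\
    (forall (r0 : R) (m : nat), (0 < r0)%R -> (1 <= m)%nat ->
       exists K U : R, (0 < U)%R /\
         forall (u : R) (z : C), (U <= u)%R -> (Cmod z <= r0)%R ->
           (Cmod (G u z -
                  / u ^ 2 * sum_n (fun s => Gstar s z / u ^ (2 * s)) (m - 1))%C
            <= K / u ^ (2 * m + 2))%R).
Proof.
  exists (ghat_star p N), (calG p N).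
  split; [apply ghat_star_regular_part|].
  split; [intros z; now apply ghat_star_0|].
  split; [intros H4 z; now apply ghat_star_1|].
  split.
  - intros u Hu jk. split.
    + exists (solution1 p N u jk), (solution2 p N u jk). intros z. split; [|split].
      * eapply is_derive_ext; [|exact (Cderiv_solution p N u jk z)].
        intros t. symmetry. now apply w_solution.
      * apply Cderiv_solution1.
      * rewrite w_solution by exact Hu. now apply solution_ode.
    + intros z. rewrite w_solution by exact Hu. now rewrite Wi_eq_Wi_deriv_0.
  - intros r0 m Hr Hm.
    destruct (calG_tail_bound p N (m - 1) N r0) as [K HK].
    exists K, 1%R. split; [lra|]. intros u z Hu Hz.
    assert (HuC : RtoC u <> 0) by (intros E; apply RtoC_inj in E; lra).
    specialize (HK u z Hu Hz).
    replace (2 * S (m - 1) + 2)%nat with (2 * m + 2)%nat in HK by lia.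
    replace (calG p N u z - / u ^ 2 * sum_n (fun s => ghat_star p N s z / u ^ (2 * s)) (m - 1))
      with (sum_n (fun s => / u ^ (2 * s + 2) * ghat_star p N s z) (m - 1 + N)
       - sum_n (fun s => / u ^ (2 * s + 2) * ghat_star p N s z) (m - 1)); [exact HK|].
    unfold calG. rewrite (Csum_extend _ N (m - 1 + N)).
    + rewrite <- Csum_scal. apply (f_equal (Cminus _)). apply Csum_ext. intros s Hs.
      rewrite Cpow_add_r. C_field. split; [now apply Cpow_nz|exact HuC].
    + lia.
    + intros k Hk. rewrite ghat_star_vanishes by lia. C_ring.
Qed.
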